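(* Let $\mathcal{H}_A=\mathcal{H}_B=\mathbb{C}^d$ and let $\mathcal{P}=(\mathcal{P}^{\mathrm{yes}},\mathcal{P}^{\mathrm{no}})$ be a property of bipartite mixed states in $\mathcal{D}(\mathcal{H}_A\otimes\mathcal{H}_B)$ that is unitarily invariant on $\mathcal{H}_B$ and such that $\mathcal{P}^{\mathrm{yes}}$ consists only of pure states. Let $0<s<c\le 1$. If there is a $(c,s)$-tester for $\mathcal{P}$ with sample complexity $N_0$, then there is a one-way LOCC tester from Bob to Alice that is a $(c,s)$-tester for $\mathcal{P}$ with sample complexity at most $\lceil 200\ln(1/s+10)(c-s)^{-4}\rceil\cdot N_0$ (in particular $O(N_0)$ for fixed $c,s$).
   Context: A property is a pair of disjoint sets of states; a $(c,s)$-tester with sample complexity $N$ is an operator $0\preceq\mathcal{T}\preceq I$ on $(\mathcal{H}_A\otimes\mathcal{H}_B)^{\otimes N}$ with $\mathrm{tr}[\mathcal{T}\rho^{\otimes N}]\ge c$ for yes-instances and $\le s$ for no-instances. Unitary invariance on $\mathcal{H}_B$: for every unitary $U$ on $\mathcal{H}_B$, $(I\otimes U)\rho(I\otimes U)^\dagger$ stays in the same set $\mathcal{P}^{\mathrm{yes}}$ or $\mathcal{P}^{\mathrm{no}}$ as $\rho$. A one-way LOCC tester from Bob to Alice is one implementable as: Bob performs a measurement on $\mathcal{H}_B^{\otimes N}$ and sends the classical outcome to Alice; Alice then performs a measurement (depending on the message) on $\mathcal{H}_A^{\otimes N}$ and accepts or rejects. *)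

(* Defs.v *)
(* R : realType (mathcomp-analysis, for ln), C := R[i]
   (mathcomp-real-closed complex numbers).  Operators on a finite-dimensional
   Hilbert space C^I (I a finite index type) are represented as functions
   I -> I -> C (matrix entries). *)
From HB Require Import structures.
From mathcomp Require Import all_boot all_order all_algebra.
From mathcomp Require Import complex.
From mathcomp Require Import reals exp.
Set Implicit Arguments. Unset Strict Implicit. Unset Printing Implicit Defensive.
Import Order.TTheory GRing.Theory Num.Theory.
Local Open Scope ring_scope.
Local Open Scope complex_scope.

Section Ops.
Variable R : realType.
Local Notation C := (R[i]).

Definition op (I : finType) := I -> I -> C.

Definition op_id (I : finType) : op I := fun i j => (i == j)%:R.
Definition op_mul (I : finType) (A B : op I) : op I :=
  fun i k => \sum_(j : I) A i j * B j k.
Definition op_adj (I : finType) (A : op I) : op I := fun i j => (A j i)^*.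
Definition op_sub (I : finType) (A B : op I) : op I := fun i j => A i j - B i j.
Definition op_tr (I : finType) (A : op I) : C := \sum_(i : I) A i i.

(* positive semidefinite: <v, A v> >= 0 for all vectors v (in C, 0 <= z means
   z is real and nonnegative) *)
Definition psd (I : finType) (A : op I) : Prop :=
  forall v : I -> C, 0 <= \sum_(i : I) \sum_(j : I) (v i)^* * A i j * v j.

Definition loewner (I : finType) (A B : op I) : Prop := psd (op_sub B A).

Definition effect (I : finType) (T : op I) : Prop :=
  psd T /\ loewner T (@op_id I).

Definition density (I : finType) (rho : op I) : Prop :=
  psd rho /\ op_tr rho = 1.

Definition pure_state (I : finType) (rho : op I) : Prop :=
  density rho /\ exists v : I -> C, rho = fun i j => v i * (v j)^*.

Definition unitary (I : finType) (U : op I) : Prop :=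
  op_mul U (op_adj U) = @op_id I /\ op_mul (op_adj U) U = @op_id I.

(* bipartite system H_A ⊗ H_B = C^d ⊗ C^d, index type 'I_d * 'I_d *)
Definition bip (d : nat) : finType := ('I_d * 'I_d)%type.

Definition idtens (d : nat) (U : op 'I_d) : op (bip d) :=
  fun i j => (i.1 == j.1)%:R * U i.2 j.2.

Definition tpow (I : finType) (N : nat) (X : op I) : op {ffun 'I_N -> I} :=
  fun i j => \prod_(k < N) X (i k) (j k).

Record property (d : nat) := Property {
  P_yes : op (bip d) -> Prop;
  P_no : op (bip d) -> Prop;
  P_yes_density : forall rho, P_yes rho -> density rho;
  P_no_density : forall rho, P_no rho -> density rho;
  P_disjoint : forall rho, P_yes rho -> P_no rho -> False }.

Definition unit_inv_B (d : nat) (P : property d) : Prop :=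
  forall U : op 'I_d, unitary U -> forall rho : op (bip d),
    (P_yes P rho -> P_yes P (op_mul (op_mul (idtens U) rho) (op_adj (idtens U)))) /\
    (P_no P rho -> P_no P (op_mul (op_mul (idtens U) rho) (op_adj (idtens U)))).

Definition tester (d : nat) (P : property d) (c s : R) (N : nat)
    (T : op {ffun 'I_N -> bip d}) : Prop :=
  effect T /\
  (forall rho, P_yes P rho -> c%:C <= op_tr (op_mul T (@tpow _ N rho))) /\
  (forall rho, P_no P rho -> op_tr (op_mul T (@tpow _ N rho)) <= s%:C).

Definition alice (d N : nat) (i : {ffun 'I_N -> bip d}) : {ffun 'I_N -> 'I_d} :=
  [ffun k => (i k).1].
Definition bob (d N : nat) (i : {ffun 'I_N -> bip d}) : {ffun 'I_N -> 'I_d} :=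
  [ffun k => (i k).2].

(* one-way LOCC operator from Bob to Alice: Bob measures H_B^{⊗N} with a POVM
   {B_m} (finite outcome set M) and sends m; Alice accepts with the effect A_m
   on H_A^{⊗N}.  The acceptance operator is  sum_m A_m ⊗ B_m. *)
Definition oneway_BA (d N : nat) (T : op {ffun 'I_N -> bip d}) : Prop :=
  exists (M : finType) (Am Bm : M -> op {ffun 'I_N -> 'I_d}),
    (forall m, effect (Am m)) /\
    (forall m, psd (Bm m)) /\
    (fun i j => \sum_(m : M) Bm m i j) = @op_id {ffun 'I_N -> 'I_d} /\
    T = fun i j => \sum_(m : M) Am m (alice i) (alice j) * Bm m (bob i) (bob j).

End Ops.

(* Main.v *)
(* Bob's only role is to certify purity.  Averaging over the symmetries of the
   problem (in the form of a minimal-norm argument) gives a tester [T] on [N0] copies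
   that commutes with every [1 \otimes U^N0], hence by polynomial continuation with
   every [1 \otimes X^N0].  Since each tensor power of a pure state is
   [1 \otimes X^N0] applied to the maximally entangled vector, [T] acts on pure states
   as some [Y \otimes 1] with [Y] an effect of Alice alone.  If [x] is the [N0]-th power
   of the largest eigenvalue of [rho], then Alice accepts [rho] by [Y] with probability
   at most [tr (T rho^N0) + 1 - x], while the swap test between two blocks of [N0]
   copies, which is a one-way LOCC measurement, accepts with probability at most
   [(1 + x) / 2].  The protocol demands at least [t] acceptances among [k] uses of [Y]
   and success of [m] block swap tests. *)
Require Import Defs.
From HB Require Import structures.
From mathcomp Require Import all_boot all_order all_algebra.
From mathcomp Require Import fingroup perm spectral complex ring lra.
From mathcomp Require Import boolp classical_sets reals topology normedtype sequences derive exp.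
Set Implicit Arguments. Unset Strict Implicit. Unset Printing Implicit Defensive.
Import Order.TTheory GRing.Theory Num.Theory numFieldNormedType.Exports.
Local Open Scope complex_scope.
Local Open Scope ring_scope.

(** * Operators and quadratic forms *)

(** Purity is promised only for yes-instances. On a mixed no-instance [T] and [Y] are compared only
    through the top eigenvector, so Alice's acceptance is bounded by [s + e] with [e = 1 - x]. Block
    swap tests accept pure states with certainty, so they cost no completeness, and each one
    multiplies the acceptance of such a no-instance by at most [1 - e / 2]. The difficulty is to
    reproduce the thresholds [c] and [s] exactly, for all [e] in [[0, 1]] at once; this dictates the
    choice of [k], [t] and [m]. That [Y] is an effect needs its own argument: [T] and [Y] agree only
    on permutation-symmetric vectors, and a product vector built from an eigenvector of [Y] need not
    be symmetric. Summing such a vector over permutations gives a symmetric eigenvector of [T] with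
    the same eigenvalue. *)

Section Operators.
Variable R : realType.
Local Notation C := R[i].
Implicit Types (I J : finType).

Definition app I (A : op R I) (v : I -> C) : I -> C := fun i => \sum_j A i j * v j.
Definition ip I (u v : I -> C) : C := \sum_i (u i)^* * v i.

Lemma quad_ip I (A : op R I) v :
  \sum_(i : I) \sum_(j : I) (v i)^* * A i j * v j = ip v (app A v).
Proof.
apply: eq_bigr => i _; rewrite /app mulr_sumr.
by apply: eq_bigr => j _; rewrite mulrA.
Qed.

Lemma psdP I (A : op R I) : psd A <-> forall v, 0 <= ip v (app A v).
Proof. by split=> h v; [rewrite -quad_ip | rewrite quad_ip]; apply: h. Qed.

(* In [ring_scope] the notation [x^*] is [Num.conj]; the definitions use [conjc] in places. *)
Lemma conjcE (x : C) : conjc x = x^*.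
Proof. by []. Qed.

Lemma op_adjE I (A : op R I) i j : op_adj A i j = (A j i)^*.
Proof. by []. Qed.

Lemma conjCR (x : R) : (x%:C)^* = x%:C.
Proof. by rewrite -conjcE /= oppr0. Qed.

Lemma conjCM_ge0 (x : C) : 0 <= x^* * x.
Proof. by rewrite mulrC mul_conjC_ge0. Qed.

Lemma conjCM_eq0 (x : C) : (x^* * x == 0) = (x == 0).
Proof. by rewrite mulf_eq0 fmorph_eq0 orbb. Qed.

Lemma conjC_ge0 (x : C) : 0 <= x -> x^* = x.
Proof. exact: geC0_conj. Qed.

Lemma conjC_nat n : (n%:R : C)^* = n%:R.
Proof. exact: rmorph_nat. Qed.

Lemma ip_ge0 I (v : I -> C) : 0 <= ip v v.
Proof. by apply: sumr_ge0 => i _; exact: conjCM_ge0. Qed.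

Lemma ip_eq0 I (v : I -> C) : ip v v = 0 -> forall i, v i = 0.
Proof.
move=> /psumr_eq0P h i; apply/eqP; rewrite -conjCM_eq0; apply/eqP/h => // j _.
exact: conjCM_ge0.
Qed.

Lemma ip_conj I (u v : I -> C) : (ip u v)^* = ip v u.
Proof.
rewrite /ip rmorph_sum; apply: eq_bigr => i _.
by rewrite rmorphM /= conjCK mulrC.
Qed.

Lemma ipZr I (u v : I -> C) a : ip u (fun i => a * v i) = a * ip u v.
Proof. by rewrite /ip mulr_sumr; apply: eq_bigr => i _; rewrite mulrCA. Qed.

Lemma ipZl I (u v : I -> C) a : ip (fun i => a * u i) v = a^* * ip u v.
Proof. by rewrite /ip mulr_sumr; apply: eq_bigr => i _; rewrite rmorphM mulrA. Qed.

Lemma ipDr I (u v w : I -> C) : ip u (fun i => v i + w i) = ip u v + ip u w.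
Proof. by rewrite /ip -big_split; apply: eq_bigr => i _; rewrite mulrDr. Qed.

Lemma ipBr I (u v w : I -> C) : ip u (fun i => v i - w i) = ip u v - ip u w.
Proof. by rewrite /ip -sumrB; apply: eq_bigr => i _; rewrite mulrBr. Qed.

Lemma ipDl I (u v w : I -> C) : ip (fun i => u i + v i) w = ip u w + ip v w.
Proof. by rewrite -ip_conj ipDr rmorphD /= !ip_conj. Qed.

Lemma appZ I (A : op R I) a v : app A (fun i => a * v i) = fun i => a * app A v i.
Proof.
by apply: funext => i; rewrite /app mulr_sumr; apply: eq_bigr => j _; rewrite mulrCA.
Qed.

Lemma appD I (A : op R I) u v :
  app A (fun i => u i + v i) = fun i => app A u i + app A v i.
Proof.
by apply: funext => i; rewrite /app -big_split; apply: eq_bigr => j _; rewrite mulrDr.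
Qed.

Lemma app_sub I (A B : op R I) v :
  app (op_sub A B) v = fun i => app A v i - app B v i.
Proof.
by apply: funext => i; rewrite /app -sumrB; apply: eq_bigr => j _; rewrite mulrBl.
Qed.

Lemma app_mul I (A B : op R I) v : app (op_mul A B) v = app A (app B v).
Proof.
apply: funext => i; rewrite /app /op_mul.
under eq_bigr do rewrite mulr_suml.
rewrite exchange_big; apply: eq_bigr => j _; rewrite mulr_sumr.
by apply: eq_bigr => k _; rewrite mulrA.
Qed.

Lemma app_id I v : app (@op_id R I) v = v.
Proof.
apply: funext => i; rewrite /app /op_id (bigD1 i) //= eqxx mul1r big1 ?addr0 // => j.
by rewrite eq_sym => /negbTE ->; rewrite mul0r.
Qed.

Lemma ip_adj I (A : op R I) u v : ip u (app A v) = ip (app (op_adj A) u) v.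
Proof.
rewrite /ip /app.
under eq_bigr do rewrite mulr_sumr.
rewrite exchange_big; apply: eq_bigr => j _ /=.
rewrite rmorph_sum mulr_suml; apply: eq_bigr => i _.
by rewrite rmorphM /= conjCK mulrCA mulrA.
Qed.

Lemma op_mulA I (A B D : op R I) : op_mul A (op_mul B D) = op_mul (op_mul A B) D.
Proof.
apply: funext => i; apply: funext => k; rewrite /op_mul.
under eq_bigr do rewrite mulr_sumr.
under [RHS]eq_bigr do rewrite mulr_suml.
by rewrite exchange_big; do 2!apply: eq_bigr => ? _; rewrite mulrA.
Qed.

Lemma op_mul1 I (A : op R I) : op_mul A (@op_id R I) = A.
Proof.
apply: funext => i; apply: funext => k; rewrite /op_mul /op_id (bigD1 k) //=.
by rewrite eqxx mulr1 big1 ?addr0 // => j /negbTE ->; rewrite mulr0.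
Qed.

Lemma op_1mul I (A : op R I) : op_mul (@op_id R I) A = A.
Proof.
apply: funext => i; apply: funext => k; rewrite /op_mul /op_id (bigD1 i) //=.
by rewrite eqxx mul1r big1 ?addr0 // => j; rewrite eq_sym => /negbTE ->; rewrite mul0r.
Qed.

Lemma op_adjM I (A B : op R I) : op_adj (op_mul A B) = op_mul (op_adj B) (op_adj A).
Proof.
apply: funext => i; apply: funext => k; rewrite op_adjE /op_mul rmorph_sum.
by apply: eq_bigr => j _; rewrite rmorphM mulrC.
Qed.

Lemma op_adjK I (A : op R I) : op_adj (op_adj A) = A.
Proof. by apply: funext => i; apply: funext => k; rewrite !op_adjE conjCK. Qed.

Lemma op_trC I (A B : op R I) : op_tr (op_mul A B) = op_tr (op_mul B A).
Proof.
rewrite /op_tr /op_mul exchange_big.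
by do 2!apply: eq_bigr => ? _; rewrite mulrC.
Qed.

Definition hermitian I (A : op R I) := forall i j, A j i = (A i j)^*.

(** Nonnegativity in [C] includes being real. The form at [e_i + a e_j] relates the imaginary parts
    of [A i j] and [A j i] for [a = 1], and their real parts for [a = 'i]. *)
Lemma psd_herm I (A : op R I) : psd A -> hermitian A.
Proof.
move=> /psdP pA.
pose s u v := ip u (app A v).
pose e (i : I) : I -> C := fun k => (k == i)%:R.
have app_e j : app A (e j) = A ^~ j.
  apply: funext => i; rewrite /app /e (bigD1 j) //= eqxx mulr1 big1 ?addr0 //.
  by move=> k /negbTE ->; rewrite mulr0.
have s_e i j : s (e i) (e j) = A i j.
  rewrite /s app_e /ip (bigD1 i) //= {1}/e eqxx conjC_nat mul1r.
  rewrite big1 ?addr0 // => k /negbTE ki.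
  by rewrite /e ki conjC_nat mul0r.
have real_s v : (s v v)^* = s v v by apply/conjC_ge0/pA.
have expand i j a : s (fun k => e i k + a * e j k) (fun k => e i k + a * e j k) =
    A i i + a * A i j + a^* * A j i + a^* * a * A j j.
  rewrite /s appD appZ ipDl !ipDr !ipZr !ipZl ?ipZr.
  by rewrite -/(s (e i) (e i)) -/(s (e i) (e j)) -/(s (e j) (e i)) -/(s (e j) (e j)) !s_e; ring.
move=> i j.
have h a := real_s (fun k => e i k + a * e j k).
have Rii k : (A k k)^* = A k k by rewrite -s_e.
have h1 := h (Complex 1 0); have h2 := h (Complex 0 1).
rewrite !expand !(rmorphD, rmorphM) /= !Rii in h1 h2.
move: h1 h2; rewrite -!conjcE.
case: (A i i) => a1 a2; case: (A j j) => b1 b2.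
case: (A i j) => c1 c2; case: (A j i) => d1 d2.
rewrite /=; simpc => -[h2] [h4]; congr (Complex _ _); lra.
Qed.

Lemma spectral I (A : op R I) : hermitian A ->
  exists (u : I -> I -> C) (l : I -> R),
    [/\ forall k m, ip (u k) (u m) = (k == m)%:R,
        forall i j, \sum_k u k i * (u k j)^* = (i == j)%:R &
        forall i j, A i j = \sum_k (l k)%:C * (u k i * (u k j)^*)].
Proof.
move=> hA; pose n := #|I|.
pose M : 'M[C]_n := \matrix_(i, j) A (enum_val i) (enum_val j).
have hM : M \is hermsymmx.
  apply/is_hermitianmxP; rewrite expr0 scale1r; apply/matrixP => i j.
  by rewrite !mxE (hA (enum_val j)).
have /orthomx_spectralP := hermitian_normalmx hM.
have /mxOverP dreal := hermitian_spectral_diag_real hM.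
set P := spectralmx M; set D := spectral_diag M => eM.
have uP : P \is unitarymx := spectral_unitarymx M.
have PPt := unitarymxP uP.
have PtP : (map_mx Num.conj P^T) *m P = 1%:M.
  by apply: mulmx1C.
rewrite (invmx_unitary uP) in eM.
pose r := @enum_rank I.
(* Here [M] is the adjoint of [P] times [D] times [P], so the eigenvectors are the conjugated rows
   of [P]. *)
exists (fun k i => (P (r k) (r i))^*), (fun k => complex.Re (D 0 (r k))); split.
- move=> k m; move/matrixP: PPt => /(_ (r k) (r m)).
  rewrite !mxE (inj_eq enum_rank_inj) => <-.
  rewrite /ip (reindex (@enum_val I I)) /=; last exact/onW_bij/enum_val_bij.
  by apply: eq_bigr => i _; rewrite !mxE /r !enum_valK conjCK.
- move=> i j; move/matrixP: PtP => /(_ (r i) (r j)).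
  rewrite !mxE (inj_eq enum_rank_inj) => <-.
  rewrite (reindex (@enum_val I I)) /=; last exact/onW_bij/enum_val_bij.
  by apply: eq_bigr => k _; rewrite !mxE /r !enum_valK conjCK.
- move=> i j; move/matrixP: eM => /(_ (r i) (r j)).
  rewrite !mxE !enum_rankK => ->.
  rewrite [RHS](reindex (@enum_val I I)) /=; last exact/onW_bij/enum_val_bij.
  apply: eq_bigr => k _; rewrite mul_mx_diag !mxE /r !enum_valK conjCK.
  have -> : (complex.Re (D 0 k))%:C = D 0 k.
    have : D 0 k \is Num.real by apply: dreal.
    by case: (D 0 k) => a b /complex_realP[x [-> ->]].
  by rewrite mulrA [D 0 k * _]mulrC.
Qed.

Lemma gram_psd (K I : finType) (Z : K -> I -> C) :
  psd (fun i j => \sum_k (Z k i)^* * Z k j).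
Proof.
move=> v; have -> : \sum_i \sum_j (v i)^* * (\sum_k (Z k i)^* * Z k j) * v j =
   \sum_k (\sum_i Z k i * v i)^* * (\sum_i Z k i * v i).
  under eq_bigr => i _ do under eq_bigr => j _ do rewrite mulr_sumr mulr_suml.
  under eq_bigr do rewrite exchange_big.
  rewrite exchange_big; apply: eq_bigr => k _ /=.
  rewrite rmorph_sum mulr_suml; apply: eq_bigr => i _.
  rewrite mulr_sumr; apply: eq_bigr => j _; rewrite rmorphM /=; ring.
by apply: sumr_ge0 => k _; exact: conjCM_ge0.
Qed.

Lemma app_eigenvector I (A : op R I) (u : I -> I -> C) (l : I -> R) :
  (forall k m, ip (u k) (u m) = (k == m)%:R) ->
  (forall i j, A i j = \sum_k (l k)%:C * (u k i * (u k j)^*)) ->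
  forall k, app A (u k) = fun i => (l k)%:C * u k i.
Proof.
move=> ou eA k; apply: funext => i; rewrite /app.
under eq_bigr do rewrite eA mulr_suml.
rewrite exchange_big (bigD1 k) //=.
have e m : \sum_j (l m)%:C * (u m i * (u m j)^*) * u k j = (l m)%:C * u m i * ip (u m) (u k).
  by rewrite /ip mulr_sumr; apply: eq_bigr => j _; ring.
rewrite e ou eqxx mulr1 big1 ?addr0 // => m /negbTE mk.
by rewrite e ou mk mulr0.
Qed.

Lemma spectral_psd I (A : op R I) (u : I -> I -> C) (l : I -> R) :
  (forall i j, A i j = \sum_k (l k)%:C * (u k i * (u k j)^*)) ->
  (forall k, 0 <= l k) -> psd A.
Proof.
move=> eA l0.
have -> : A = fun i j => \sum_k ((Num.sqrt (l k))%:C * (u k i)^*)^* *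
                                 ((Num.sqrt (l k))%:C * (u k j)^*).
  apply: funext => i; apply: funext => j; rewrite eA; apply: eq_bigr => k _.
  rewrite rmorphM /= conjCK conjCR mulrACA -rmorphM -expr2 sqr_sqrtr //.
exact: gram_psd.
Qed.

Lemma psd_spectral I (A : op R I) : psd A ->
  exists (u : I -> I -> C) (l : I -> R),
    [/\ forall k m, ip (u k) (u m) = (k == m)%:R,
        forall i j, A i j = \sum_k (l k)%:C * (u k i * (u k j)^*) &
        forall k, 0 <= l k].
Proof.
move=> pA; have [u [l [ou _ eA]]] := spectral (psd_herm pA).
exists u, l; split=> // k; move/psdP: pA => /(_ (u k)).
by rewrite (app_eigenvector ou eA) ipZr ou eqxx mulr1 ler0c.
Qed.

Lemma psd_gram I (A : op R I) : psd A ->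
  exists Z : I -> I -> C, A = fun i j => \sum_k (Z k i)^* * Z k j.
Proof.
move=> /psd_spectral[u [l [ou eA l0]]].
exists (fun k i => (Num.sqrt (l k))%:C * (u k i)^*).
apply: funext => i; apply: funext => j; rewrite eA; apply: eq_bigr => k _.
by rewrite rmorphM /= conjCK conjCR mulrACA -rmorphM -expr2 sqr_sqrtr.
Qed.

(** Schur product theorem: products of Gram vectors are Gram vectors of the entrywise product. When
    [f] and [g] are complementary coordinates this is the tensor product. *)
Lemma psd_schur (I I1 I2 : finType) (f : I -> I1) (g : I -> I2) (A : op R I1) (B : op R I2) :
  psd A -> psd B -> psd (fun i j => A (f i) (f j) * B (g i) (g j)).
Proof.
move=> /psd_gram[Z ->] /psd_gram[W ->].
have -> : (fun i j => (\sum_k (Z k (f i))^* * Z k (f j)) *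
                      (\sum_k (W k (g i))^* * W k (g j))) =
   fun i j => \sum_(k : I1 * I2) (Z k.1 (f i) * W k.2 (g i))^* * (Z k.1 (f j) * W k.2 (g j)).
  apply: funext => i; apply: funext => j; rewrite big_distrlr pair_bigA /=.
  by apply: eq_bigr => k _; rewrite rmorphM /=; ring.
exact: gram_psd.
Qed.

Lemma psdD I (A B : op R I) : psd A -> psd B -> psd (fun i j => A i j + B i j).
Proof.
move=> /psdP pA /psdP pB; apply/psdP => v.
have -> : app (fun i j => A i j + B i j) v = fun i => app A v i + app B v i.
  by apply: funext => i; rewrite /app -big_split; apply: eq_bigr => j _; rewrite mulrDl.
by rewrite ipDr addr_ge0.
Qed.

Lemma psd_sum (K I : finType) (A : K -> op R I) :
  (forall k, psd (A k)) -> psd (fun i j => \sum_k A k i j).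
Proof.
move=> pA v; under eq_bigr => i _ do under eq_bigr => j _ do rewrite mulr_sumr mulr_suml.
under eq_bigr do rewrite exchange_big.
by rewrite exchange_big; apply: sumr_ge0 => k _; apply: pA.
Qed.

Lemma psd_id I : psd (@op_id R I).
Proof. by apply/psdP => v; rewrite app_id ip_ge0. Qed.

Lemma psd0 I : psd (fun _ _ : I => 0 : C).
Proof. by move=> v; do 2!(apply: sumr_ge0 => ? _); rewrite mulr0 mul0r. Qed.

Lemma effect_le I (A : op R I) v : effect A -> ip v (app A v) <= ip v v.
Proof.
by case=> _ /psdP /(_ v); rewrite app_sub app_id ipBr subr_ge0.
Qed.

Lemma effectP I (A : op R I) :
  (forall v, 0 <= ip v (app A v) /\ ip v (app A v) <= ip v v) -> effect A.
Proof.
move=> h; split; apply/psdP => v; first by case: (h v).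
by rewrite app_sub app_id ipBr subr_ge0; case: (h v).
Qed.

Lemma tr_rank1 I (T : op R I) v : op_tr (op_mul T (fun i j => v i * (v j)^*)) = ip v (app T v).
Proof.
rewrite /op_tr /op_mul /ip /app; apply: eq_bigr => i _.
by rewrite mulr_sumr; apply: eq_bigr => j _; ring.
Qed.

Lemma tr_mul_sum (K I : finType) (T : op R I) (a : K -> C) (v : K -> I -> C) :
  op_tr (op_mul T (fun i j => \sum_k a k * (v k i * (v k j)^*))) =
  \sum_k a k * ip (v k) (app T (v k)).
Proof.
under [RHS]eq_bigr do rewrite -tr_rank1.
rewrite /op_tr /op_mul; under [RHS]eq_bigr do rewrite mulr_sumr.
rewrite [RHS]exchange_big; apply: eq_bigr => i _ /=.
under [RHS]eq_bigr do rewrite mulr_sumr.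
rewrite [RHS]exchange_big; apply: eq_bigr => j _ /=.
by rewrite mulr_sumr; apply: eq_bigr => k _; ring.
Qed.

End Operators.

(** * Invariant points of affine families of operators *)

Section FixedPoint.
Variable R : realType.
Local Notation C := R[i].
Local Open Scope classical_set_scope.
Variable I : finType.

Definition sqnorm (T : op R I) : C := \sum_i \sum_j `|T i j| ^+ 2.

(** Real and imaginary parts become separate coordinates of a real row vector, where compactness and
    the extreme value theorem apply. *)
Let J : finType := (I * I * bool)%type.
Let rank := @enum_rank J.
Let decode (x : 'rV[R]_#|J|) : op R I :=
  fun i j => Complex (x 0 (rank (i, j, false))) (x 0 (rank (i, j, true))).
Let encode (T : op R I) : 'rV[R]_#|J| :=
  \row_k let: (i, j, b) := enum_val k in
         if b then complex.Im (T i j) else complex.Re (T i j).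
Let N (x : 'rV[R]_#|J|) : R := \sum_k x 0 k ^+ 2.

Let encodeK T : decode (encode T) = T.
Proof.
apply: funext => i; apply: funext => j.
by rewrite /decode !mxE /rank !enum_rankK; case: (T i j).
Qed.

Let sqnormE x : sqnorm (decode x) = (N x)%:C.
Proof.
rewrite /N (reindex rank) /=; last exact/onW_bij/enum_rank_bij.
have -> : \sum_p x 0 (rank p) ^+ 2 = \sum_i \sum_j \sum_b x 0 (rank (i, j, b)) ^+ 2.
  by rewrite pair_bigA pair_bigA /=; apply: eq_bigr => -[[]].
rewrite rmorph_sum; apply: eq_bigr => i _; rewrite rmorph_sum.
apply: eq_bigr => j _; rewrite big_bool /= normCK -conjcE /decode /=; simpc.
by rewrite /real_complex_def; congr (Complex _ _); ring.
Qed.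

Let continuous_sum (K : finType) (f : K -> 'rV[R]_#|J| -> R) :
  (forall k, continuous (f k)) -> continuous (fun x => \sum_k f k x).
Proof. 
move=> cf; have := @continuous_big R K +%R 0 xpredT _ _ (index_enum K) f.
move=> /(_ (@pseudometric_normed_Zmodule.add_continuous R R)); apply=> k _; exact: cf. Qed.

Let continuous_coord (a : R) k : continuous (fun x : 'rV[R]_#|J| => a * x 0 k).
Proof.
move=> x; apply: (@continuousM R _ (fun=> a) (fun x : 'rV[R]_#|J| => x 0 k)).
  exact: cst_continuous.
exact: coord_continuous.
Qed.

Let continuous_lin (a b : R) k m :
  continuous (fun x : 'rV[R]_#|J| => a * x 0 k + b * x 0 m).
Proof.
move=> x; apply: (@continuousD R R _ (fun x : 'rV[R]_#|J| => a * x 0 k)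
                                     (fun x : 'rV[R]_#|J| => b * x 0 m));
  exact: continuous_coord.
Qed.

Let continuous_shift (a : R) (f : 'rV[R]_#|J| -> R) :
  continuous f -> continuous (fun x => a + f x).
Proof.
move=> cf x; apply: (@continuousD R R _ (fun=> a) f); last exact: cf.
exact: cst_continuous.
Qed.

Let N_continuous : continuous N.
Proof.
apply: continuous_sum => k x.
apply: (@continuousM R _ (fun x : 'rV[R]_#|J| => x 0 k) (fun x : 'rV[R]_#|J| => x 0 k));
  exact: coord_continuous.
Qed.

(* A nonempty family of operators cut out by (possibly infinitely many) affine
   inequalities is convex and closed, so it has a point of minimal Hilbert-Schmidt
   norm; being unique, it is fixed by every symmetry of the family. *)
Lemma affine_fixed_point (A : Type) (b : A -> C) (l : A -> op R I)
    (K := fun T : op R I => forall a, 0 <= b a + \sum_i \sum_j l a i j * T i j) :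
  (exists T, K T) ->
  exists T, K T /\ forall F : op R I -> op R I,
    (forall S, K S -> K (F S)) -> sqnorm (F T) = sqnorm T -> F T = T.
Proof.
move=> [T0 KT0].
(* Cutting at the norm of [T0] makes the set bounded without losing any point of minimal norm. *)
pose E := [set x | K (decode x)] `&` [set x | N x <= N (encode T0)].
have E0 : E !=set0 by exists (encode T0); split => //=; rewrite encodeK.
have clE : closed E.
  apply: closedI; last first.
    exact: (continuous_closedP _).1 N_continuous _ (@closed_le _ _).
  have -> : [set x | K (decode x)] =
     \bigcap_(a in setT) [set x | 0 <= b a + \sum_i \sum_j l a i j * decode x i j].
    by apply/seteqP; split=> x h a => [_|]; exact: h.
  apply: closed_bigI => a _.
  pose g x := b a + \sum_i \sum_j l a i j * decode x i j.
  have -> : [set x | 0 <= g x] =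
      [set x | complex.Im (g x) = 0] `&` [set x | 0 <= complex.Re (g x)].
    apply/seteqP; split=> x; rewrite /= lecE /=; first by case/andP => /eqP.
    by case=> -> ->; rewrite eqxx.
  have gRe x : complex.Re (g x) = complex.Re (b a) +
      \sum_i \sum_j (complex.Re (l a i j) * x 0 (rank (i, j, false)) +
                     - complex.Im (l a i j) * x 0 (rank (i, j, true))).
    rewrite /g raddfD raddf_sum /=; congr (_ + _); apply: eq_bigr => i _.
    by rewrite raddf_sum; apply: eq_bigr => j _; case: (l a i j) => p q; rewrite /= ?mulNr.
  have gIm x : complex.Im (g x) = complex.Im (b a) +
      \sum_i \sum_j (complex.Re (l a i j) * x 0 (rank (i, j, true)) +
                     complex.Im (l a i j) * x 0 (rank (i, j, false))).
    rewrite /g raddfD raddf_sum /=; congr (_ + _); apply: eq_bigr => i _.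
    by rewrite raddf_sum; apply: eq_bigr => j _; case: (l a i j) => p q; rewrite /= ?mulNr.
  apply: closedI.
    apply: (continuous_closedP (fun x => complex.Im (g x))).1 _ _ (@closed_eq _ 0).
    rewrite (funext gIm); apply: continuous_shift; do 2!apply: continuous_sum => ?.
    exact: continuous_lin.
  apply: (continuous_closedP (fun x => complex.Re (g x))).1 _ _ (@closed_ge _ 0).
  rewrite (funext gRe); apply: continuous_shift; do 2!apply: continuous_sum => ?.
  exact: continuous_lin.
have cE : compact E.
  (* A coordinate whose square is at most [N (encode T0)] is at most this bound in absolute value;
     no square root is involved. *)
  pose B := N (encode T0) + 1.
  have cB : compact [set v : 'rV[R]_#|J| | forall k, `[(- B), B]%classic (v ord0 k)].
    by apply: (@rV_compact R _ (fun=> `[(- B), B]%classic)) => _; exact: segment_compact.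
  apply: subclosed_compact clE cB _ => x [_ /= xB] k.
  have h : x 0 k ^+ 2 <= N (encode T0).
    apply: le_trans xB; rewrite /N (bigD1 k) //= lerDl.
    by apply: sumr_ge0 => i _; rewrite sqr_ge0.
  by rewrite /= in_itv /= /B; apply/andP; split; nra.
have [x] := EVT_min_rV E0 cE (continuous_subspaceT N_continuous).
rewrite inE => -[Kx xT0] xmin.
have {}xmin y : K (decode y) -> N x <= N y.
  move=> Ky; case: (leP (N y) (N (encode T0))) => h; last exact: le_trans xT0 (ltW h).
  by apply: xmin; rewrite inE; split.
exists (decode x); split=> // F KF nF; set y := encode (F (decode x)).
have eF : F (decode x) = decode y by rewrite encodeK.
have Ny : N y = N x by apply: (@complexI R); rewrite -!sqnormE -eF.
(* The midpoint of [x] and [y] stays in the family. By the parallelogram identity its squared norm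
   is smaller by a quarter of the squared distance, so minimality forces [y = x]. *)
have Kz : K (decode (\row_k (2^-1 * (x 0 k + y 0 k)))).
  move=> a; have := Kx a; have := KF _ Kx a; rewrite eF => h1 h2.
  have -> : b a + \sum_i \sum_j l a i j * decode (\row_k (2^-1 * (x 0 k + y 0 k))) i j =
    (2^-1)%:C * ((b a + \sum_i \sum_j l a i j * decode x i j) +
                (b a + \sum_i \sum_j l a i j * decode y i j)).
    rewrite addrACA -big_split mulrDr /=; congr (_ + _).
      have -> : b a + b a = 2%:C * b a by rewrite rmorph_nat mulr_natl.
      by rewrite mulrA -rmorphM mulVf ?pnatr_eq0 // mul1r.
    rewrite mulr_sumr; apply: eq_bigr => i _; rewrite -big_split mulr_sumr.
    apply: eq_bigr => j _ /=; rewrite -mulrDr mulrCA; congr (_ * _).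
    by rewrite /decode !mxE; simpc.
  by apply: mulr_ge0; [rewrite ler0c invr_ge0 | apply: addr_ge0].
have := xmin _ Kz.
have -> : N (\row_k (2^-1 * (x 0 k + y 0 k))) =
    2^-1 * (N x + N y) - 4^-1 * \sum_k (x 0 k - y 0 k) ^+ 2.
  rewrite /N -big_split !mulr_sumr -sumrB; apply: eq_bigr => k _; rewrite mxE /=.
  by field.
rewrite Ny => h.
have /psumr_eq0P xy : \sum_k (x 0 k - y 0 k) ^+ 2 = 0.
  apply/eqP; rewrite eq_le sumr_ge0 ?andbT; last by move=> k _; rewrite sqr_ge0.
  lra.
rewrite eF; congr decode; apply/rowP => k; apply/eqP; rewrite eq_sym -subr_eq0.
by rewrite -sqrf_eq0; apply/eqP/xy => // i _; rewrite sqr_ge0.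
Qed.

End FixedPoint.

(** * Tensor products *)

Section ProductIndices.
Variable R : realType.
Local Notation C := R[i].

(** Treats the splitting into Alice and Bob and the splitting into two groups of copies alike: in
    both, a tensor product is the entrywise product of operators read through [f] and [g]. *)
Definition coordinates (I X Y : finType) (f : I -> X) (g : I -> Y) :=
  exists h : X -> Y -> I,
    [/\ forall a b, f (h a b) = a, forall a b, g (h a b) = b &
        forall i, h (f i) (g i) = i].

Lemma sum_coordinates (I X Y : finType) (f : I -> X) (g : I -> Y) (F : X -> Y -> C) :
  coordinates f g -> \sum_i F (f i) (g i) = \sum_a \sum_b F a b.
Proof.
case=> h [fh gh hfg]; rewrite pair_bigA /=.
rewrite [RHS](reindex (fun i => (f i, g i))) //.
by exists (fun p => h p.1 p.2) => [i _|[a b] _] /=; rewrite ?hfg ?fh ?gh.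
Qed.

Lemma eq_coordinates (I X Y : finType) (f : I -> X) (g : I -> Y) i j :
  coordinates f g -> (i == j) = (f i == f j) && (g i == g j).
Proof.
case=> h [fh gh hfg]; apply/eqP/andP => [->|[/eqP ef /eqP eg]]; first by rewrite !eqxx.
by rewrite -(hfg i) -(hfg j) ef eg.
Qed.

Lemma op_id_coordinates (I X Y : finType) (f : I -> X) (g : I -> Y) i j :
  coordinates f g -> op_id R i j = op_id R (f i) (f j) * op_id R (g i) (g j).
Proof. by move=> fg; rewrite /op_id (eq_coordinates i j fg) -natrM mulnb. Qed.

Definition zipf d N (a b : {ffun 'I_N -> 'I_d}) : {ffun 'I_N -> bip d} :=
  [ffun k => (a k, b k)].

Lemma alice_zipf d N (a b : {ffun 'I_N -> 'I_d}) : alice (zipf a b) = a.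
Proof. by apply/ffunP => k; rewrite !ffunE. Qed.

Lemma bob_zipf d N (a b : {ffun 'I_N -> 'I_d}) : bob (zipf a b) = b.
Proof. by apply/ffunP => k; rewrite !ffunE. Qed.

Lemma coordinates_bip d N : coordinates (@alice d N) (@bob d N).
Proof.
exists (@zipf d N); split=> [a b|a b|i]; rewrite ?alice_zipf ?bob_zipf //.
by apply/ffunP => k; rewrite !ffunE; case: (i k).
Qed.

Definition lpart (I : finType) N1 N2 (i : {ffun 'I_(N1 + N2) -> I}) : {ffun 'I_N1 -> I} :=
  [ffun k => i (lshift N2 k)].
Definition rpart (I : finType) N1 N2 (i : {ffun 'I_(N1 + N2) -> I}) : {ffun 'I_N2 -> I} :=
  [ffun k => i (rshift N1 k)].
Definition joinf (I : finType) N1 N2 (a : {ffun 'I_N1 -> I}) (b : {ffun 'I_N2 -> I}) :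
  {ffun 'I_(N1 + N2) -> I} :=
  [ffun k => match split k with inl x => a x | inr y => b y end].

Lemma lpart_joinf (I : finType) N1 N2 (a : {ffun 'I_N1 -> I}) (b : {ffun 'I_N2 -> I}) :
  lpart (joinf a b) = a.
Proof. by apply/ffunP => k; rewrite !ffunE (unsplitK (inl k)). Qed.

Lemma rpart_joinf (I : finType) N1 N2 (a : {ffun 'I_N1 -> I}) (b : {ffun 'I_N2 -> I}) :
  rpart (joinf a b) = b.
Proof. by apply/ffunP => k; rewrite !ffunE (unsplitK (inr k)). Qed.

Lemma joinf_parts (I : finType) N1 N2 (i : {ffun 'I_(N1 + N2) -> I}) :
  joinf (lpart i) (rpart i) = i.
Proof.
by apply/ffunP => k; rewrite !ffunE; case: splitP => x e; rewrite !ffunE;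
   congr (i _); apply: val_inj.
Qed.

Lemma coordinates_parts (I : finType) N1 N2 :
  coordinates (@lpart I N1 N2) (@rpart I N1 N2).
Proof.
exists (@joinf I N1 N2); split=> *;
  by rewrite ?lpart_joinf ?rpart_joinf ?joinf_parts.
Qed.

Lemma alice_lpart d N1 N2 (i : {ffun 'I_(N1 + N2) -> bip d}) :
  lpart (alice i) = alice (lpart i).
Proof. by apply/ffunP => k; rewrite !ffunE. Qed.

Lemma alice_rpart d N1 N2 (i : {ffun 'I_(N1 + N2) -> bip d}) :
  rpart (alice i) = alice (rpart i).
Proof. by apply/ffunP => k; rewrite !ffunE. Qed.

Lemma bob_lpart d N1 N2 (i : {ffun 'I_(N1 + N2) -> bip d}) :
  lpart (bob i) = bob (lpart i).
Proof. by apply/ffunP => k; rewrite !ffunE. Qed.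

Lemma bob_rpart d N1 N2 (i : {ffun 'I_(N1 + N2) -> bip d}) :
  rpart (bob i) = bob (rpart i).
Proof. by apply/ffunP => k; rewrite !ffunE. Qed.

End ProductIndices.

(** * Tensor powers of operators and vectors *)

Section TensorPower.
Variable R : realType.
Local Notation C := R[i].
Variable I : finType.
Implicit Types (A B : op R I) (N : nat).

Definition tvec N (v : I -> C) : {ffun 'I_N -> I} -> C := fun i => \prod_k v (i k).

Lemma tpow_mul N A B : tpow (N := N) (op_mul A B) = op_mul (tpow A) (tpow B).
Proof.
apply: funext => i; apply: funext => k; rewrite /tpow /op_mul bigA_distr_bigA.
by apply: eq_bigr => j _; rewrite big_split.
Qed.

Lemma tpow_adj N A : tpow (N := N) (op_adj A) = op_adj (tpow A).
Proof.
apply: funext => i; apply: funext => j; rewrite op_adjE /tpow rmorph_prod.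
by apply: eq_bigr => k _; rewrite op_adjE.
Qed.

Lemma tpow_id N : tpow (N := N) (@op_id R I) = @op_id R _.
Proof.
apply: funext => i; apply: funext => j; rewrite /tpow /op_id.
case: eqP => [->|ne]; first by rewrite big1 // => k _; rewrite eqxx.
apply/eqP; rewrite prodf_seq_eq0; apply/hasP.
have /existsP[k kn] : [exists k, i k != j k].
  by rewrite -negb_forall; apply/negP => /forallP h; apply/ne/ffunP => k; apply/eqP.
by exists k; rewrite ?mem_index_enum //= (negbTE kn).
Qed.

Lemma app_tpow N A v : app (tpow (N := N) A) (tvec v) = tvec (app A v).
Proof.
apply: funext => i; rewrite /tvec /app bigA_distr_bigA.
by apply: eq_bigr => j _; rewrite -big_split.
Qed.

Lemma tpow_rank1 N v :
  tpow (N := N) (fun i j => v i * (v j)^*) = fun i j => tvec v i * (tvec v j)^* :> C.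
Proof.
by apply: funext => i; apply: funext => j; rewrite /tpow big_split /= rmorph_prod.
Qed.

Lemma tpow_parts N1 N2 A (i j : {ffun 'I_(N1 + N2) -> I}) :
  tpow A i j = tpow A (lpart i) (lpart j) * tpow A (rpart i) (rpart j).
Proof.
rewrite /tpow big_split_ord /=; congr (_ * _);
by apply: eq_bigr => k _; rewrite !ffunE.
Qed.

Lemma tr_tpow N A : op_tr (tpow (N := N) A) = op_tr A ^+ N.
Proof.
rewrite /op_tr /tpow -(bigA_distr_bigA (fun (_ : 'I_N) i => A i i)) prodr_const.
by rewrite card_ord.
Qed.

Lemma tr_tpow_sqr N A : op_tr (op_mul (tpow (N := N) A) (tpow A)) = op_tr (op_mul A A) ^+ N.
Proof. by rewrite -tpow_mul tr_tpow. Qed.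

Lemma tr_tpow_parts N1 N2 (A : op R {ffun 'I_N1 -> I}) (B : op R {ffun 'I_N2 -> I}) rho :
  op_tr (op_mul (fun i j => A (lpart i) (lpart j) * B (rpart i) (rpart j)) (tpow rho)) =
  op_tr (op_mul A (tpow rho)) * op_tr (op_mul B (tpow rho)).
Proof.
have cp := coordinates_parts I N1 N2.
pose H a b a' b' := (A a a' * tpow rho a' a) * (B b b' * tpow rho b' b).
rewrite /op_tr /op_mul.
transitivity (\sum_a \sum_b \sum_a' \sum_b' H a b a' b').
  rewrite -(sum_coordinates (fun a b => \sum_a' \sum_b' H a b a' b') cp).
  apply: eq_bigr => i _; rewrite -(sum_coordinates (H (lpart i) (rpart i)) cp).
  by apply: eq_bigr => j _; rewrite tpow_parts /H; ring.
rewrite big_distrlr; apply: eq_bigr => a _; apply: eq_bigr => b _.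
by rewrite big_distrlr.
Qed.

End TensorPower.

(** * Local protocols *)

Section Protocols.
Variables (R : realType) (d : nat).
Local Notation C := R[i].

(** Protocols are tracked only through their acceptance probability on independent copies, so
    composing them becomes arithmetic on [F]. *)
Definition acceptance N (T : op R {ffun 'I_N -> bip d}) (F : op R (bip d) -> R) :=
  forall rho, density rho -> op_tr (op_mul T (tpow rho)) = (F rho)%:C.

Definition lift_alice N (E : op R {ffun 'I_N -> 'I_d}) : op R {ffun 'I_N -> bip d} :=
  fun i j => E (alice i) (alice j) * op_id R (bob i) (bob j).

Definition alice_test N (F : op R (bip d) -> R) :=
  exists E : op R {ffun 'I_N -> 'I_d}, effect E /\ acceptance (lift_alice E) F.

Definition locc_test N (F : op R (bip d) -> R) :=
  exists T : op R {ffun 'I_N -> bip d}, oneway_BA T /\ acceptance T F.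

Lemma effect_id (I : finType) : effect (@op_id R I).
Proof.
split; first exact: psd_id.
rewrite /loewner.
have -> : op_sub (@op_id R I) (@op_id R I) = fun _ _ => 0.
  by apply: funext => i; apply: funext => j; rewrite /op_sub subrr.
exact: psd0.
Qed.

(** A branching measurement: the outcome of [E1] decides whether [E2] or [E3] is applied to the
    other factor. Its complement is the same branching with [E2] and [E3] complemented, hence also
    positive. *)
Lemma effect_coordinates (I X Y : finType) (f : I -> X) (g : I -> Y) E1 E2 E3 :
  coordinates f g -> effect E1 -> effect E2 -> effect E3 ->
  @effect R I (fun i j => E1 (f i) (f j) * E2 (g i) (g j) +
                    op_sub (@op_id R X) E1 (f i) (f j) * E3 (g i) (g j)).
Proof.
move=> fg [p1 q1] [p2 q2] [p3 q3]; split; first by apply: psdD; exact: psd_schur.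
rewrite /loewner.
have -> : op_sub (@op_id R I) (fun i j => E1 (f i) (f j) * E2 (g i) (g j) +
                    op_sub (@op_id R X) E1 (f i) (f j) * E3 (g i) (g j)) =
   fun i j => E1 (f i) (f j) * op_sub (@op_id R Y) E2 (g i) (g j) +
      op_sub (@op_id R X) E1 (f i) (f j) * op_sub (@op_id R Y) E3 (g i) (g j).
  apply: funext => i; apply: funext => j.
  by rewrite /op_sub (op_id_coordinates R i j fg); ring.
by apply: psdD; exact: psd_schur.
Qed.

Lemma effect_prod (I X Y : finType) (f : I -> X) (g : I -> Y) E1 E2 :
  coordinates f g -> effect E1 -> effect E2 ->
  @effect R I (fun i j => E1 (f i) (f j) * E2 (g i) (g j)).
Proof.
move=> fg e1 e2.
have e0 : @effect R Y (fun _ _ => 0).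
  split; first exact: psd0.
  rewrite /loewner; suff -> : op_sub (@op_id R Y) (fun _ _ => 0) = @op_id R Y by exact: psd_id.
  by apply: funext => i; apply: funext => j; rewrite /op_sub subr0.
have := effect_coordinates fg e1 e2 e0.
congr effect; apply: funext => i; apply: funext => j.
by rewrite mulr0 addr0.
Qed.

Lemma lift_alice_effect N (E : op R {ffun 'I_N -> 'I_d}) :
  effect E -> effect (lift_alice E).
Proof.
by move=> eE; apply: (effect_prod (coordinates_bip d N) eE); exact: effect_id.
Qed.

Lemma sum_unit (F : unit -> C) : \sum_m F m = F tt.
Proof. by rewrite (bigD1 tt) //= big1 ?addr0 // => -[]. Qed.

Lemma alice_locc N F : alice_test N F -> locc_test N F.
Proof.
case=> E [eE aE]; exists (lift_alice E); split=> //.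
exists unit, (fun=> E), (fun=> @op_id R _); split=> //; split; first by move=> _; exact: psd_id.
by split; apply: funext => i; apply: funext => j; rewrite sum_unit.
Qed.

Lemma oneway_effect N (T : op R {ffun 'I_N -> bip d}) : oneway_BA T -> effect T.
Proof.
case=> M [A [B [eA [pB [sB ->]]]]]; have cb := coordinates_bip d N.
split; first by apply: psd_sum => m; apply: psd_schur => //; case: (eA m).
rewrite /loewner.
(* Since Bob's POVM sums to the identity, rejection is the one-way operator with Alice's effects
   complemented. *)
have -> : op_sub (@op_id R _) (fun i j => \sum_m A m (alice i) (alice j) * B m (bob i) (bob j)) =
  fun i j => \sum_m op_sub (@op_id R _) (A m) (alice i) (alice j) * B m (bob i) (bob j).
  apply: funext => i; apply: funext => j; rewrite /op_sub (op_id_coordinates R i j cb).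
  under [RHS]eq_bigr do rewrite mulrBl.
  by rewrite sumrB -mulr_sumr -sB.
by apply: psd_sum => m; apply: psd_schur => //; case: (eA m).
Qed.

Lemma locc_prod N1 N2 F1 F2 : locc_test N1 F1 -> locc_test N2 F2 ->
  locc_test (N1 + N2) (fun rho => F1 rho * F2 rho).
Proof.
case=> T1 [[M1 [A1 [B1 [eA1 [pB1 [sB1 eT1]]]]]] a1].
case=> T2 [[M2 [A2 [B2 [eA2 [pB2 [sB2 eT2]]]]]] a2].
have cp := coordinates_parts 'I_d N1 N2.
exists (fun i j => T1 (lpart i) (lpart j) * T2 (rpart i) (rpart j)); split; last first.
  by move=> rho drho; rewrite tr_tpow_parts a1 // a2 // rmorphM.
exists (M1 * M2)%type,
  (fun m i j => A1 m.1 (lpart i) (lpart j) * A2 m.2 (rpart i) (rpart j)),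
  (fun m i j => B1 m.1 (lpart i) (lpart j) * B2 m.2 (rpart i) (rpart j)).
split; first by move=> m; exact: effect_prod.
split; first by move=> m; exact: psd_schur.
split; apply: funext => i; apply: funext => j.
  rewrite (op_id_coordinates R i j cp) -sB1 -sB2 big_distrlr pair_bigA /=.
  by apply: eq_bigr.
rewrite eT1 eT2 big_distrlr pair_bigA /=; apply: eq_bigr => m _.
by rewrite !alice_lpart !alice_rpart !bob_lpart !bob_rpart; ring.
Qed.

Lemma tr_id_tpow N (rho : op R (bip d)) : density rho ->
  op_tr (op_mul (@op_id R _) (tpow (N := N) rho)) = 1.
Proof. by case=> _ tr1; rewrite op_1mul tr_tpow tr1 expr1n. Qed.

Lemma alice_test1 N : alice_test N (fun=> 1).
Proof.
exists (@op_id R _); split; first exact: effect_id.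
move=> rho drho; have -> : lift_alice (@op_id R _) = @op_id R {ffun 'I_N -> bip d}.
  apply: funext => i; apply: funext => j.
  by rewrite (op_id_coordinates R i j (coordinates_bip d N)).
by rewrite tr_id_tpow.
Qed.

Lemma alice_test0 N : alice_test N (fun=> 0).
Proof.
exists (fun _ _ => 0); split.
  split; first exact: psd0.
  rewrite /loewner.
  have -> : op_sub (@op_id R {ffun 'I_N -> 'I_d}) (fun _ _ => 0) = @op_id R _.
    by apply: funext => i; apply: funext => j; rewrite /op_sub subr0.
  exact: psd_id.
move=> rho _; rewrite /op_tr big1 // => i _; rewrite /op_mul big1 // => j _.
by rewrite /lift_alice !mul0r.
Qed.

Lemma locc_test1 : locc_test 0 (fun=> 1).
Proof. exact/alice_locc/alice_test1. Qed.

Lemma locc_exp N F m : locc_test N F -> locc_test (m * N) (fun rho => F rho ^+ m).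
Proof.
move=> tF; elim: m => [|m IH].
  rewrite mul0n (_ : (fun rho => F rho ^+ 0) = fun=> 1); first exact: locc_test1.
  by apply: funext => rho; rewrite expr0.
rewrite mulSn (_ : (fun rho => F rho ^+ m.+1) = fun rho => F rho * F rho ^+ m).
  exact: locc_prod.
by apply: funext => rho; rewrite exprS.
Qed.

(** Alice branches on her own outcome and continues on fresh copies; this is the recursion step of
    the threshold test below. *)
Lemma alice_if N1 N2 F G H : alice_test N1 F -> alice_test N2 G -> alice_test N2 H ->
  alice_test (N1 + N2) (fun rho => F rho * G rho + (1 - F rho) * H rho).
Proof.
case=> E1 [e1 a1] [E2 [e2 a2]] [E3 [e3 a3]].
have cp := coordinates_parts 'I_d N1 N2.
exists (fun i j => E1 (lpart i) (lpart j) * E2 (rpart i) (rpart j) +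
    op_sub (@op_id R _) E1 (lpart i) (lpart j) * E3 (rpart i) (rpart j)).
split; first exact: effect_coordinates.
move=> rho drho; rewrite rmorphD !rmorphM rmorphB rmorph1 /= -!(a1, a2, a3) //.
rewrite -(tr_id_tpow N1 drho).
have -> : op_tr (op_mul (@op_id R _) (tpow (N := N1) rho)) -
          op_tr (op_mul (lift_alice E1) (tpow rho)) =
  op_tr (op_mul (lift_alice (op_sub (@op_id R _) E1)) (tpow rho)).
  rewrite /op_tr -sumrB; apply: eq_bigr => i _; rewrite /op_mul -sumrB.
  apply: eq_bigr => j _; rewrite -mulrBl; congr (_ * _).
  by rewrite (op_id_coordinates R i j (coordinates_bip d N1)) /lift_alice /op_sub mulrBl.
rewrite -!tr_tpow_parts /op_tr -big_split; apply: eq_bigr => i _.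
rewrite /op_mul -big_split; apply: eq_bigr => j _ /=.
rewrite -mulrDl; congr (_ * _); rewrite /lift_alice.
rewrite (op_id_coordinates R _ _ (coordinates_parts 'I_d N1 N2)).
by rewrite !alice_lpart !alice_rpart !bob_lpart !bob_rpart; ring.
Qed.

(* Probability of at least [t] successes in [k] Bernoulli([y]) trials. *)
Fixpoint bin_tail (k t : nat) (y : R) {struct k} : R :=
  match k, t with
  | _, 0%N => 1
  | 0%N, _.+1 => 0
  | k'.+1, t'.+1 => y * bin_tail k' t' y + (1 - y) * bin_tail k' t y
  end.

Lemma alice_bin_tail N F k t : alice_test N F ->
  alice_test (k * N) (fun rho => bin_tail k t (F rho)).
Proof.
move=> tF; elim: k t => [|k IH] [|t] /=; do ?exact: alice_test1.
  exact: alice_test0.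
by rewrite mulSn; apply: alice_if.
Qed.

Lemma op_id_conj (X : finType) (i j : X) : (op_id R i j)^* = op_id R i j.
Proof. exact: conjC_nat. Qed.

Lemma sum_op_id (X : finType) (a : X) (G : X -> C) : \sum_k op_id R k a * G k = G a.
Proof.
rewrite (bigD1 a) //= /op_id eqxx mul1r big1 ?addr0 // => k /negbTE ->.
by rewrite mul0r.
Qed.

Lemma ReK (z : C) : 0 <= z -> (complex.Re z)%:C = z.
Proof. by case: z => a b; rewrite lecE /= => /andP[/eqP -> _]. Qed.

Definition block_swap (X : finType) N (i : {ffun 'I_(N + N) -> X}) := joinf (rpart i) (lpart i).

Lemma block_swapK (X : finType) N : involutive (@block_swap X N).
Proof. by move=> i; rewrite /block_swap rpart_joinf lpart_joinf joinf_parts. Qed.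

Lemma alice_swap N (i : {ffun 'I_(N + N) -> bip d}) :
  alice (block_swap i) = block_swap (alice i).
Proof. by apply/ffunP => k; rewrite !ffunE; case: (split k) => x; rewrite !ffunE. Qed.

Lemma bob_swap N (i : {ffun 'I_(N + N) -> bip d}) :
  bob (block_swap i) = block_swap (bob i).
Proof. by apply/ffunP => k; rewrite !ffunE; case: (split k) => x; rewrite !ffunE. Qed.

(** The projector onto the eigenspace of the block swap for the eigenvalue [(-1) ^+ e]. *)
Definition swap_proj (X : finType) N (e : bool) : op R {ffun 'I_(N + N) -> X} :=
  fun i j => (op_id R i j + (-1) ^+ e * op_id R i (block_swap j)) / 2%:R.

(** A self-adjoint idempotent is its own Gram matrix, and the complement of one sign is the other
    sign. *)
Lemma swap_proj_effect (X : finType) N e : effect (@swap_proj X N e).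
Proof.
have sym (i j : {ffun 'I_(N + N) -> X}) : op_id R (block_swap i) j = op_id R i (block_swap j).
  by rewrite /op_id -(can_eq (@block_swapK X N)) block_swapK.
have pP b : psd (@swap_proj X N b).
  have -> : @swap_proj X N b = fun i j => \sum_k (swap_proj b k i)^* * swap_proj b k j.
    apply: funext => i; apply: funext => j.
    pose h : C := (-1) ^+ b; have hh : h * h = 1 by rewrite -expr2 sqrr_sign.
    have -> : \sum_k (swap_proj b k i)^* * swap_proj b k j =
      \sum_k op_id R k i * (swap_proj b k j / 2%:R) +
      \sum_k op_id R k (block_swap i) * (h * swap_proj b k j / 2%:R).
      rewrite -big_split; apply: eq_bigr => k _ /=.
      rewrite {1}/swap_proj fmorph_div rmorphD rmorphM rmorph_sign rmorph_nat /= !op_id_conj /h.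
      by field.
    rewrite !sum_op_id /swap_proj -/h !sym block_swapK.
    have -> : op_id R i (block_swap j) = h * h * op_id R i (block_swap j) by rewrite hh mul1r.
    have -> : forall x y : C, (x + h * (h * h * y)) / 2%:R / 2%:R +
      h * ((h * h * y + h * x) / 2%:R) / 2%:R =
      (x * (1 + h * h) + h * h * h * y * (1 + 1)) / 2%:R / 2%:R by move=> x y; field.
    by rewrite hh; field.
  exact: gram_psd.
split; first exact: pP.
rewrite /loewner; have -> : op_sub (@op_id R _) (@swap_proj X N e) = @swap_proj X N (~~ e).
  apply: funext => i; apply: funext => j; rewrite /op_sub /swap_proj.
  by case: e; rewrite /= ?expr0 ?expr1; field.
exact: pP.
Qed.

Lemma tr_sqr_ge0 (rho : op R (bip d)) : density rho -> 0 <= op_tr (op_mul rho rho).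
Proof.
case=> /psd_herm h _; apply: sumr_ge0 => i _; apply: sumr_ge0 => j _.
by rewrite (h i j) mul_conjC_ge0.
Qed.

(* On two blocks, the projector onto the swap-symmetric subspace is
   [(1 + S_A S_B) / 2 = \sum_e (1 + e S_A) / 2 * (1 + e S_B) / 2] over the signs [e]. *)
Lemma block_swap_test N :
  locc_test (N + N)
    (fun rho => (1 + complex.Re (op_tr (op_mul rho rho)) ^+ N) / 2).
Proof.
have cb := coordinates_bip d (N + N).
pose T : op R {ffun 'I_(N + N) -> bip d} := fun i j =>
  (op_id R i j + op_id R i (block_swap j)) / 2%:R.
exists T; split.
  exists bool, (@swap_proj 'I_d N), (@swap_proj 'I_d N).
  split; first exact: swap_proj_effect.
  split; first by move=> e; case: (swap_proj_effect 'I_d N e).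
  split; apply: funext => i; apply: funext => j; rewrite big_bool /= /swap_proj expr0 expr1.
    by field.
  rewrite /T (op_id_coordinates R i j cb) (op_id_coordinates R i _ cb) alice_swap bob_swap.
  by field.
move=> rho drho.
(* The swap trick: the block swap traced against two copies of [rho ^ N] gives the trace of the
   square of [rho ^ N], which is [tr (rho ^ 2) ^ N]. *)
transitivity ((op_tr (op_mul (@op_id R _) (tpow (N := N + N) rho)) +
   \sum_(j : {ffun 'I_(N + N) -> bip d}) tpow rho j (block_swap j)) / 2%:R).
  have -> : \sum_(j : {ffun 'I_(N + N) -> bip d}) tpow rho j (block_swap j) =
     \sum_(i : {ffun 'I_(N + N) -> bip d}) \sum_j op_id R i (block_swap j) * tpow rho j i.
    by rewrite exchange_big; apply: eq_bigr => j _; rewrite sum_op_id.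
  rewrite /op_tr -big_split mulr_suml; apply: eq_bigr => i _ /=.
  rewrite /op_mul -big_split mulr_suml; apply: eq_bigr => j _ /=.
  by rewrite /T; field.
rewrite tr_id_tpow // fmorph_div rmorphD rmorph1 rmorph_nat rmorphXn /= ReK ?tr_sqr_ge0 //.
congr ((_ + _) / _); rewrite -tr_tpow_sqr.
rewrite /op_tr /op_mul -(sum_coordinates (fun a b => tpow rho a b * tpow rho b a)
   (coordinates_parts (bip d) N N)).
apply: eq_bigr => i _; rewrite tpow_parts /block_swap lpart_joinf rpart_joinf //.
Qed.

End Protocols.

(** * Commutation with local tensor powers *)

Section Commutant.
Variables (R : realType) (d N : nat) (T : op R {ffun 'I_N -> bip d}).
Local Notation C := R[i].

Definition local_commute (X : op R 'I_d) :=
  op_mul T (tpow (idtens X)) = op_mul (tpow (idtens X)) T.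

Lemma idtens_mul (X Y : op R 'I_d) : idtens (op_mul X Y) = op_mul (idtens X) (idtens Y).
Proof.
apply: funext => -[a b]; apply: funext => -[a' b']; rewrite /idtens /op_mul /=.
rewrite -(pair_bigA _ (fun p q => (a == p)%:R * X b q * ((p == a')%:R * Y q b'))) /=.
rewrite [RHS](bigD1 a) //= [X in _ = _ + X]big1 ?addr0; last first.
  by move=> p; rewrite eq_sym => /negbTE ->; rewrite big1 // => q _; rewrite !mul0r.
by rewrite mulr_sumr; apply: eq_bigr => q _; rewrite eqxx mul1r mulrCA.
Qed.

Lemma idtens_adj (X : op R 'I_d) : op_adj (idtens X) = idtens (op_adj X).
Proof.
apply: funext => -[a b]; apply: funext => -[a' b'].
by rewrite op_adjE /idtens /= rmorphM /= conjC_nat eq_sym op_adjE.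
Qed.

Lemma idtens_id : idtens (@op_id R 'I_d) = @op_id R (bip d).
Proof.
apply: funext => -[a b]; apply: funext => -[a' b'].
by rewrite /idtens /op_id /= xpair_eqE -natrM mulnb.
Qed.

Lemma unitary_tpow (U : op R 'I_d) : unitary U -> unitary (tpow (N := N) (idtens U)).
Proof.
by case=> h1 h2; split; rewrite -tpow_adj -tpow_mul idtens_adj -idtens_mul ?h1 ?h2
  idtens_id tpow_id.
Qed.

Lemma local_commute_mul X Y :
  local_commute X -> local_commute Y -> local_commute (op_mul X Y).
Proof.
rewrite /local_commute idtens_mul tpow_mul => cX cY.
by rewrite op_mulA cX -op_mulA -cY op_mulA.
Qed.

Lemma local_commute_id : local_commute (@op_id R _).
Proof. by rewrite /local_commute idtens_id tpow_id op_mul1 op_1mul. Qed.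

Lemma poly_eq0_inj (p : {poly C}) (z : nat -> C) :
  injective z -> (forall n, p.[z n] = 0) -> p = 0.
Proof.
move=> zi pz; apply: (roots_geq_poly_eq0 (rs := map z (iota 0 (size p)))).
- by apply/allP => _ /mapP[n _ ->]; apply/eqP.
- by rewrite map_inj_uniq ?iota_uniq.
- by rewrite size_map size_iota.
Qed.

(* Commutation is polynomial in the matrix entries, so it propagates along complex lines. *)
Lemma local_commute_line (A B : op R 'I_d) (z : nat -> C) : injective z ->
  (forall n, local_commute (fun i j => A i j + z n * B i j)) ->
  forall w, local_commute (fun i j => A i j + w * B i j).
Proof.
move=> zi cz w; apply: funext => i; apply: funext => l.
pose P (j m : {ffun 'I_N -> bip d}) : {poly C} :=
  \prod_k ((idtens A (j k) (m k))%:P + (idtens B (j k) (m k))%:P * 'X).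
pose p := \sum_j (T i j)%:P * P j l - \sum_j P i j * (T j l)%:P.
have PE x j m : (P j m).[x] = tpow (N := N) (idtens (fun i j => A i j + x * B i j)) j m.
  rewrite /P horner_prod /tpow; apply: eq_bigr => k _.
  by rewrite !hornerE /idtens; ring.
have pE x : p.[x] = op_mul T (tpow (idtens (fun i j => A i j + x * B i j))) i l -
                    op_mul (tpow (idtens (fun i j => A i j + x * B i j))) T i l.
  rewrite /p hornerD hornerN !horner_sum /op_mul; congr (_ - _);
  by apply: eq_bigr => j _; rewrite hornerM hornerC PE.
have p0 : p = 0.
  by apply: (poly_eq0_inj zi) => n; rewrite pE (cz n) subrr.
by apply/eqP; rewrite -subr_eq0 -pE p0 horner0.
Qed.

Hypothesis commute_unitary : forall U, unitary U -> local_commute U.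

(** For a unit vector [v], scales the line of [v] by [z] and fixes its orthogonal complement; it is
    unitary when [z] has modulus 1. *)
Definition dilation (v : 'I_d -> C) (z : C) : op R 'I_d :=
  fun i j => (op_id R i j - v i * (v j)^*) + z * (v i * (v j)^*).

Lemma dilation_mul v z w : ip v v = 1 ->
  op_mul (dilation v z) (dilation v w) = dilation v (z * w).
Proof.
move=> v1; apply: funext => i; apply: funext => j; rewrite /op_mul /dilation.
transitivity (\sum_k op_id R k i * (dilation v w k j) +
   \sum_k (z - 1) * (v i * (v k)^*) * (op_id R k j) +
   (z - 1) * (w - 1) * (v i * (v j)^*) * ip v v).
  rewrite mulr_sumr -!big_split; apply: eq_bigr => k _ /=.
  have -> : op_id R i k = op_id R k i by rewrite /op_id eq_sym.
  by rewrite /dilation; ring.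
rewrite sum_op_id v1; under eq_bigr do rewrite mulrC.
by rewrite sum_op_id /dilation; ring.
Qed.

Lemma dilation1 v : dilation v 1 = @op_id R _.
Proof. by apply: funext => i; apply: funext => j; rewrite /dilation; ring. Qed.

Lemma dilation_adj v z : op_adj (dilation v z) = dilation v z^*.
Proof.
apply: funext => i; apply: funext => j; rewrite op_adjE /dilation.
by rewrite !(rmorphB, rmorphD, rmorphM) /= !conjCK op_id_conj /op_id eq_sym; ring.
Qed.

Lemma local_commute_dilation v z : ip v v = 1 -> local_commute (dilation v z).
Proof.
(* The rational parametrization of the circle at the integers supplies infinitely many [z] of
   modulus 1. The parameter is recovered as [Im / (1 + Re)], which gives injectivity. *)
move=> v1; pose D (n : nat) : R := 1 + n%:R ^+ 2.
have D0 n : D n != 0 by rewrite lt0r_neq0 // ltr_wpDr ?sqr_ge0.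
pose u n : C := Complex ((1 - n%:R ^+ 2) / D n) (2 * n%:R / D n).
have uu n : u n * (u n)^* = 1.
  rewrite -conjcE /u; simpc; congr (Complex _ _); last by ring.
  by move: (D0 n); rewrite /D => h; field.
apply: (@local_commute_line _ _ u) => [n m|n].
  move=> h; have hi := congr1 (@complex.Im R) h; have hr := congr1 (@complex.Re R) h.
  have nE k : (k%:R : R) = complex.Im (u k) / (1 + complex.Re (u k)).
    rewrite /u /=; have -> : 1 + (1 - k%:R ^+ 2) / D k = 2 / D k.
      by move: (D0 k); rewrite /D => h'; field.
    by move: (D0 k) => h'; field.
  by apply/eqP; rewrite -(eqr_nat R) nE hi hr -nE.
apply: commute_unitary; split; rewrite dilation_adj dilation_mul //.
  by rewrite uu dilation1.
by rewrite mulrC uu dilation1.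
Qed.

Lemma local_commute_hermitian (H : op R 'I_d) : hermitian H -> local_commute H.
Proof.
move=> /spectral[u [l [ou cu eH]]].
(* A hermitian operator is the product of the dilations along an eigenbasis by its eigenvalues;
   orthogonality kills the cross terms, so partial products have this additive form. *)
have step (s : seq 'I_d) : uniq s ->
    local_commute (fun i j => op_id R i j + \sum_(k <- s) ((l k)%:C - 1) * (u k i * (u k j)^*)).
  elim: s => [_|k s IH /= /andP[ks us]].
    rewrite (_ : (fun _ _ => _) = @op_id R _); first exact: local_commute_id.
    by apply: funext => i; apply: funext => j; rewrite big_nil addr0.
  have uk : ip (u k) (u k) = 1 by rewrite ou eqxx.
  have := local_commute_mul (local_commute_dilation (l k)%:C uk) (IH us).
  rewrite (_ : op_mul _ _ = fun i j => op_id R i j +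
    \sum_(m <- k :: s) ((l m)%:C - 1) * (u m i * (u m j)^*)) //.
  apply: funext => i; apply: funext => j; rewrite big_cons /op_mul /dilation.
  pose G n := op_id R n j + \sum_(m <- s) ((l m)%:C - 1) * (u m n * (u m j)^*).
  transitivity (\sum_n op_id R n i * G n +
     \sum_n op_id R n j * (((l k)%:C - 1) * (u k i * (u k n)^*)) +
     \sum_n ((l k)%:C - 1) * u k i *
       ((u k n)^* * \sum_(m <- s) ((l m)%:C - 1) * (u m n * (u m j)^*))).
    rewrite -!big_split; apply: eq_bigr => n _ /=.
    have -> : op_id R i n = op_id R n i by rewrite /op_id eq_sym.
    by rewrite /G; ring.
  rewrite !sum_op_id -mulr_sumr.
  rewrite [X in _ + _ * X](_ : _ = 0).
    by rewrite /G; ring.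
  under eq_bigr do rewrite mulr_sumr.
  rewrite exchange_big big_seq big1 // => m ms.
  rewrite (_ : \sum_n _ = ((l m)%:C - 1) * (u m j)^* * ip (u k) (u m)); last first.
    by rewrite /ip mulr_sumr; apply: eq_bigr => n _; ring.
  by rewrite ou; case: eqP ks => [->|_ _]; rewrite ?ms ?mulr0.
have := step _ (index_enum_uniq 'I_d).
rewrite (_ : (fun _ _ => _) = H) //; apply: funext => i; apply: funext => j.
rewrite eH; under eq_bigr do rewrite mulrBl mul1r.
by rewrite sumrB cu /op_id addrCA subrr addr0.
Qed.

(** Write [X = A + 'i B] with [A] and [B] hermitian. Then [A + n B] is hermitian for every natural
    [n], and the line through these points is continued to ['i]. *)
Lemma local_commute_all X : local_commute X.
Proof.
pose A : op R 'I_d := fun i j => (X i j + (X j i)^*) / 2%:R.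
pose B : op R 'I_d := fun i j => (X i j - (X j i)^*) / 2%:R / 'i.
have hA : hermitian A.
  by move=> i j; rewrite /A fmorph_div rmorphD rmorph_nat /= conjCK addrC.
have hB : hermitian B.
  move=> i j; rewrite /B !fmorph_div rmorphB rmorph_nat /= conjCK conjCi.
  by rewrite invrN mulrN -mulNr -mulNr opprB.
have -> : X = fun i j => A i j + 'i * B i j.
  apply: funext => i; apply: funext => j; rewrite /A /B.
  have i0 : ('i : C) != 0 := neq0Ci _.
  by field.
apply: (@local_commute_line _ _ (fun n => n%:R)) => [n m /eqP|n].
  by rewrite eqr_nat => /eqP.
apply: local_commute_hermitian => i j.
by clearbody A B; rewrite /= rmorphD rmorphM rmorph_nat /= -hA -hB.
Qed.

End Commutant.

(** * Reduction to a test of Alice alone *)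

Section Polarization.
Variables (R : realType) (N : nat) (I : finType).
Local Notation C := R[i].

Definition pact (X : finType) (s : 'S_N) (i : {ffun 'I_N -> X}) : {ffun 'I_N -> X} :=
  [ffun k => i (s k)].

Lemma pactM (X : finType) s t (i : {ffun 'I_N -> X}) : pact s (pact t i) = pact (s * t)%g i.
Proof. by apply/ffunP => k; rewrite !ffunE permM. Qed.

Lemma pact1 (X : finType) (i : {ffun 'I_N -> X}) : pact 1%g i = i.
Proof. by apply/ffunP => k; rewrite !ffunE perm1. Qed.

Lemma pact_bij (X : finType) s : bijective (@pact X s).
Proof. by exists (@pact X s^-1%g) => i; rewrite pactM ?mulVg ?mulgV pact1. Qed.

Lemma sum_pact (X : finType) s (F : {ffun 'I_N -> X} -> C) : \sum_i F (pact s i) = \sum_i F i.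
Proof. by rewrite [RHS](reindex (pact s)) //; exact/onW_bij/pact_bij. Qed.

(* Inclusion-exclusion extracts the surjective, hence bijective, index maps. *)
Lemma sum_sign_surj (h : {ffun 'I_N -> 'I_N}) :
  \sum_(e : {ffun 'I_N -> bool}) (\prod_m (-1) ^+ (~~ e m)) * \prod_k (e (h k))%:R =
  (injectiveb h)%:R :> C.
Proof.
pose c m := #|[pred k | h k == m]|.
transitivity (\prod_m \sum_(b : bool) (-1) ^+ (~~ b) * b%:R ^+ c m : C).
  rewrite bigA_distr_bigA; apply: eq_bigr => e _; rewrite big_split /=; congr (_ * _).
  rewrite (partition_big h predT) //=; apply: eq_bigr => m _.
  rewrite (eq_bigr (fun=> (e m)%:R)) ?prodr_const // => k /eqP -> //.
under eq_bigr do rewrite big_bool /= expr0 expr1 mul1r expr1n mulN1r expr0n.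
case: injectiveP => [hi|hni].
  rewrite big1 // => m _; rewrite [c m == _](_ : _ = false) ?subr0 //.
  apply/negbTE; rewrite -lt0n; apply/card_gt0P.
  by have /codomP[k ->] := injF_onto hi m; exists k; rewrite inE.
have [m cm] : exists m, m \notin codom h.
  apply/existsP; rewrite -negb_forall; apply/negP => /forallP hs; apply: hni.
  suff /eqP/image_injP h' : #|fintype.image h predT| = #|'I_N| by move=> x y; exact: h'.
  by apply: eq_card => x; rewrite hs.
rewrite (bigD1 m) //= [c m == _](_ : _ = true) ?subrr ?mul0r //.
apply/eqP/eq_card0 => k; rewrite inE; apply/negP => /eqP e.
by move: cm; rewrite -e codom_f.
Qed.

Lemma sum_orbit_eq0 (f : {ffun 'I_N -> I} -> C) :
  (forall v, \sum_i f i * tvec v i = 0) -> forall i, \sum_(s : 'S_N) f (pact s i) = 0.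
Proof.
move=> f0 i0.
(* The sum of the basis vectors at [i0 m] over the [m] selected by [e]. Its tensor power expands
   over all maps [h] of the positions, and the signed sum over [e] keeps only the permutations,
   which leaves the orbit sum of [f] at [i0]. *)
pose v (e : {ffun 'I_N -> bool}) x : C := \sum_m (e m)%:R * (i0 m == x)%:R.
have tv e i : tvec (v e) i =
    \sum_(h : {ffun 'I_N -> 'I_N}) (\prod_k (e (h k))%:R) * (i == [ffun k => i0 (h k)])%:R.
  rewrite /tvec /v bigA_distr_bigA; apply: eq_bigr => h _; rewrite big_split /=.
  congr (_ * _); have := congr1 (fun F => F [ffun k => i0 (h k)] i) (tpow_id R I N).
  rewrite /tpow /op_id eq_sym => <-; apply: eq_bigr => k _; by rewrite ffunE.
transitivity (\sum_(e : {ffun 'I_N -> bool})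
    (\prod_m (-1) ^+ (~~ e m)) * \sum_i f i * tvec (v e) i);
  last by rewrite big1 // => e _; rewrite f0 mulr0.
transitivity (\sum_(h : {ffun 'I_N -> 'I_N}) f [ffun k => i0 (h k)] * (injectiveb h)%:R).
  rewrite (bigID (fun h : {ffun 'I_N -> 'I_N} => injectiveb h)) /= [X in _ = _ + X]big1; last first.
    by move=> h /negbTE ->; rewrite mulr0.
  rewrite addr0 (reindex (@pval _)) /=; last first.
    (* The default value is never reached, because only injective maps are reindexed. *)
    pose in_SN := insubd (1%g : 'S_N).
    by exists in_SN => /= h hi; first apply: val_inj; apply: insubdK.
  apply: eq_big => [s|s _]; first by rewrite (valP s).
  rewrite (valP s) mulr1; congr f; apply/ffunP => k; rewrite !ffunE.
  by rewrite pvalE.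
have ftv e : \sum_i f i * tvec (v e) i =
    \sum_(h : {ffun 'I_N -> 'I_N}) f [ffun k => i0 (h k)] * \prod_k (e (h k))%:R.
  under eq_bigr do rewrite tv mulr_sumr.
  rewrite exchange_big; apply: eq_bigr => h _ /=.
  rewrite (bigD1 [ffun k => i0 (h k)]) //= eqxx mulr1 [X in _ + X]big1 ?addr0 //.
  by move=> i /negbTE ->; rewrite !mulr0.
under [RHS]eq_bigr do rewrite ftv mulr_sumr.
rewrite [RHS]exchange_big; apply: eq_bigr => h _ /=.
by rewrite -sum_sign_surj mulr_sumr; apply: eq_bigr => e _; rewrite mulrCA.
Qed.

(** Averaging [f] over permutations does not change its pairing with a symmetric [w], and the
    average vanishes. *)
Lemma polarization (f : {ffun 'I_N -> I} -> C) (w : {ffun 'I_N -> I} -> C) :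
  (forall v, \sum_i f i * tvec v i = 0) -> (forall s i, w (pact s i) = w i) ->
  \sum_i f i * w i = 0.
Proof.
move=> f0 ws; apply/eqP.
have : (#|'S_N|%:R : C) * \sum_i f i * w i = 0.
  rewrite mulr_natl -sumr_const.
  under eq_bigr => s _ do rewrite -(sum_pact s).
  rewrite exchange_big big1 // => i _ /=; under eq_bigr do rewrite ws.
  by rewrite -mulr_suml sum_orbit_eq0 ?mul0r.
move/eqP; rewrite mulf_eq0 pnatr_eq0 => /orP[/eqP|//].
by move/eqP; rewrite -leqn0 leqNgt card_Sn fact_gt0.
Qed.

End Polarization.

(** * Alice's effect extracted from a symmetric tester *)

Section Reduction.
Variables (R : realType) (d N : nat) (T : op R {ffun 'I_N -> bip d}).
Local Notation C := R[i].
Hypothesis effT : effect T.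
Hypothesis commT : forall X, local_commute T X.
Hypothesis permT : forall s i j, T (pact s i) (pact s j) = T i j.

(* [T] maps the maximally entangled vector to [(Y \otimes 1)] applied to it. *)
Definition reduction : op R {ffun 'I_N -> 'I_d} :=
  fun a a' => \sum_b T (zipf a a') (zipf b b).
Local Notation Y := reduction.

Let cb := coordinates_bip d N.

Lemma app_lift_alice (E : op R {ffun 'I_N -> 'I_d}) w i :
  app (lift_alice E) w i = \sum_a E (alice i) a * w (zipf a (bob i)).
Proof.
rewrite /app; pose F a b := E (alice i) a * op_id R (bob i) b * w (zipf a b).
rewrite (eq_bigr (fun j => F (alice j) (bob j))) => [|j _]; last first.
  rewrite /F /lift_alice; congr (_ * w _).
  by case: cb => h [ha hb hi]; apply/ffunP => k; rewrite !ffunE; case: (j k).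
rewrite (sum_coordinates F cb); apply: eq_bigr => a _; rewrite /F.
under eq_bigr do rewrite [E _ _ * _]mulrC -mulrA /op_id eq_sym -/(op_id R _ _).
by rewrite sum_op_id.
Qed.

Lemma op_id_ffun (X : finType) (a b : {ffun 'I_N -> X}) :
  op_id R a b = \prod_k op_id R (a k) (b k).
Proof. exact/esym/(congr1 (fun F => F a b) (tpow_id R X N)). Qed.

Let omega : {ffun 'I_N -> bip d} -> C := tvec (fun p => (p.1 == p.2)%:R).

Let omegaE i : omega i = op_id R (alice i) (bob i).
Proof.
rewrite op_id_ffun /omega /tvec.
by apply: eq_bigr => k _; rewrite /op_id !ffunE.
Qed.

Let sum_omega (F : {ffun 'I_N -> bip d} -> C) : \sum_j F j * omega j = \sum_b F (zipf b b).
Proof.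
pose G a b := F (zipf a b) * op_id R a b.
rewrite (eq_bigr (fun j => G (alice j) (bob j))) => [|j _]; last first.
  rewrite /G omegaE; congr (F _ * _).
  by apply/ffunP => k; rewrite !ffunE; case: (j k).
rewrite (sum_coordinates G cb) exchange_big; apply: eq_bigr => b _ /=.
by rewrite /G; under eq_bigr do rewrite mulrC; rewrite sum_op_id.
Qed.

Let app_omega i : app T omega i = Y (alice i) (bob i).
Proof.
rewrite /app sum_omega /reduction; apply: eq_bigr => b _; congr (T _ _).
by apply/ffunP => k; rewrite !ffunE; case: (i k).
Qed.

Lemma app_reduction_tvec v : app T (tvec v) = app (lift_alice Y) (tvec v).
Proof.
pose X : op R 'I_d := fun b a => v (a, b).
have ev : v = app (idtens X) (fun p => (p.1 == p.2)%:R).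
  apply: funext => -[a b]; rewrite /app.
  rewrite -(pair_bigA _ (fun p q => idtens X (a, b) (p, q) * (p == q)%:R)) /=.
  rewrite (bigD1 a) //= [X in _ = _ + X]big1 ?addr0; last first.
    move=> p; rewrite eq_sym => /negbTE pa; rewrite big1 // => q _.
    by rewrite /idtens /= pa !mul0r.
  rewrite (bigD1 a) //= big1 ?addr0 => [|q].
    by rewrite /idtens /= !eqxx mul1r mulr1.
  by rewrite eq_sym => /negbTE ->; rewrite mulr0.
have tX (i j : {ffun 'I_N -> bip d}) :
    tpow (idtens X) i j = op_id R (alice i) (alice j) * tpow X (bob i) (bob j).
  rewrite op_id_ffun /tpow -big_split; apply: eq_bigr => k _.
  by rewrite /idtens /op_id !ffunE.
rewrite {1}ev -app_tpow -app_mul commT app_mul; apply: funext => i.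
rewrite app_lift_alice {1}/app.
pose G a b := op_id R a (alice i) * (tpow X (bob i) b * Y a b).
rewrite (eq_bigr (fun j => G (alice j) (bob j))) => [|j _]; last first.
  by rewrite app_omega tX /G -mulrA /op_id eq_sym.
rewrite (sum_coordinates G cb) exchange_big; apply: eq_bigr => b _ /=.
rewrite sum_op_id mulrC; congr (_ * _); rewrite /tpow /tvec.
by apply: eq_bigr => k _; rewrite /X !ffunE.
Qed.

(** Extends the agreement beyond tensor powers, since the vectors that test hermiticity and
    eigenvalues of [Y] below are symmetric but need not be tensor powers. *)
Lemma app_reduction w : (forall s i, w (pact s i) = w i) ->
  app T w = app (lift_alice Y) w.
Proof.
move=> ws; apply: funext => i; apply/eqP; rewrite -subr_eq0 /app -sumrB; apply/eqP.
rewrite (eq_bigr (fun j => (T i j - lift_alice Y i j) * w j)) => [|j _]; last by rewrite mulrBl.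
apply: polarization => // v.
under eq_bigr do rewrite mulrBl.
by rewrite sumrB -/(app T (tvec v) i) app_reduction_tvec subrr.
Qed.

Lemma pact_zipf s (a b : {ffun 'I_N -> 'I_d}) : zipf (pact s a) (pact s b) = pact s (zipf a b).
Proof. by apply/ffunP => k; rewrite !ffunE. Qed.

Lemma alice_pact s (i : {ffun 'I_N -> bip d}) : alice (pact s i) = pact s (alice i).
Proof. by apply/ffunP => k; rewrite !ffunE. Qed.

Lemma bob_pact s (i : {ffun 'I_N -> bip d}) : bob (pact s i) = pact s (bob i).
Proof. by apply/ffunP => k; rewrite !ffunE. Qed.

Lemma reduction_pact s a a' : Y (pact s a) (pact s a') = Y a a'.
Proof.
by rewrite /reduction -(sum_pact s); apply: eq_bigr => b _; rewrite !pact_zipf permT.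
Qed.

(** The defect [D = Y - Y^*], read as a bipartite vector, is itself symmetric. Moving [T] across its
    inner product with [omega] therefore shows that the squared norm of [D] is zero. *)
Lemma reduction_herm : hermitian Y.
Proof.
pose D a b := Y a b - (Y b a)^*.
pose w i := D (alice i) (bob i).
have ws s i : w (pact s i) = w i by rewrite /w /D alice_pact bob_pact !reduction_pact.
have Tadj : op_adj T = T.
  case: effT => /psd_herm hT _; apply: funext => i; apply: funext => j.
  by rewrite op_adjE -hT.
have e : ip w (app T omega) = ip (app T w) omega by rewrite ip_adj Tadj.
have e1 : ip w (app T omega) = \sum_a \sum_b (D a b)^* * Y a b.
  rewrite -(sum_coordinates (fun a b => (D a b)^* * Y a b) cb).
  by apply: eq_bigr => i _; rewrite app_omega.
have e2 : ip (app T w) omega = \sum_a \sum_b (D a b)^* * (Y b a)^*.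
  rewrite /ip sum_omega exchange_big; apply: eq_bigr => b _ /=.
  rewrite app_reduction // app_lift_alice alice_zipf bob_zipf rmorph_sum.
  by apply: eq_bigr => a _; rewrite /w alice_zipf bob_zipf rmorphM mulrC.
have : \sum_a \sum_b (D a b)^* * D a b = 0.
  transitivity (ip w (app T omega) - ip (app T w) omega); last by rewrite e subrr.
  rewrite e1 e2 -sumrB; apply: eq_bigr => a _; rewrite -sumrB.
  by apply: eq_bigr => b _; rewrite -mulrBr.
rewrite pair_bigA => /psumr_eq0P D0 a b; apply/eqP; rewrite -subr_eq0 -/(D b a).
rewrite -conjCM_eq0; apply/eqP; apply: (D0 _ (b, a)) => // p _; exact: conjCM_ge0.
Qed.

Lemma reduction_effect : effect Y.
Proof.
have [u [l [ou cu eY]]] := spectral reduction_herm.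
have l01 k : 0 <= l k <= 1.
  (* Symmetrising [u k] tensored with its conjugate gives an eigenvector of [T] for [l k], because
     [Y] commutes with permutations. It is nonzero since its diagonal sums to the order of ['S_N];
     so [l k] is an eigenvalue of the effect [T]. *)
  pose sigma a b : C := \sum_(s : 'S_N) u k (pact s a) * (u k (pact s b))^*.
  pose w i := sigma (alice i) (bob i).
  have ws s i : w (pact s i) = w i.
    rewrite /w /sigma alice_pact bob_pact [RHS](reindex (fun t => t * s)%g) /=; last first.
      by apply/onW_bij; exists (fun t => t * s^-1)%g => t; rewrite ?mulgK ?mulgKV.
    by apply: eq_bigr => t _; rewrite !pactM.
  have Tw : app T w = fun i => (l k)%:C * w i.
    rewrite app_reduction //; apply: funext => i; rewrite app_lift_alice.
    rewrite /w /sigma mulr_sumr; under eq_bigr do rewrite alice_zipf bob_zipf mulr_sumr.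
    rewrite exchange_big; apply: eq_bigr => s _ /=.
    under eq_bigr do rewrite -(reduction_pact s) mulrA.
    rewrite -mulr_suml mulrA; congr (_ * _).
    rewrite (sum_pact s (fun a => Y (pact s (alice i)) a * u k a)).
    by rewrite -/(app Y (u k) _) (app_eigenvector ou eY).
  have w0 : 0 < ip w w.
    rewrite lt0r ip_ge0 andbT; apply/eqP => /ip_eq0 wz.
    have : \sum_a w (zipf a a) = #|'S_N|%:R.
      under eq_bigr do rewrite /w alice_zipf bob_zipf /sigma.
      rewrite exchange_big -sumr_const; apply: eq_bigr => s _ /=.
      rewrite (sum_pact s (fun a => u k a * (u k a)^*)).
      under eq_bigr do rewrite mulrC.
      by rewrite -/(ip (u k) (u k)) ou eqxx.
    rewrite big1 // => /eqP; rewrite eq_sym pnatr_eq0 card_Sn.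
    by rewrite -leqn0 leqNgt fact_gt0.
  have [/psdP pT _] := effT; have := pT w; have := effect_le w effT.
  rewrite Tw ipZr -{2}[ip w w]mul1r ler_pM2r // pmulr_lge0 // => h1 h0.
  by rewrite -ler0c h0 -lecR.
split; first by apply: (spectral_psd eY) => k; case/andP: (l01 k).
apply: (@spectral_psd _ _ _ u (fun k => 1 - l k)) => [i j|k]; last first.
  by rewrite subr_ge0; case/andP: (l01 k).
rewrite /op_sub /op_id -cu eY -sumrB; apply: eq_bigr => k _.
by rewrite rmorphB rmorph1 mulrBl mul1r.
Qed.

Lemma ip_reduction v :
  ip (tvec v) (app (lift_alice Y) (tvec v)) = ip (tvec v) (app T (tvec v)).
Proof. by rewrite app_reduction_tvec. Qed.

End Reduction.

(** * Amplification *)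

Section Amplification.
Variable R : realType.
Implicit Types (k t m : nat) (c s y z e : R).

(* Markov's inequality for [z ^ X], with [X] binomial. *)
Lemma bin_tail_lower k t y z : 0 <= y <= 1 -> 0 <= z <= 1 ->
  (1 - bin_tail k t y) * z ^+ t <= z * (1 - y + y * z) ^+ k.
Proof.
move=> /andP[y0 y1] /andP[z0 z1].
have M0 : 0 <= 1 - y + y * z by rewrite addr_ge0 ?subr_ge0 ?mulr_ge0.
elim: k t => [|k IH] [|t] /=.
- by rewrite subrr mul0r expr0 mulr1.
- by rewrite subr0 mul1r expr0 mulr1 exprS ler_piMr ?exprn_ile1.
- by rewrite subrr mul0r mulr_ge0 ?exprn_ge0.
- have h1 := ler_wpM2l (mulr_ge0 y0 z0) (IH t).
  have h2 : (1 - y) * ((1 - bin_tail k t.+1 y) * z ^+ t.+1) <= (1 - y) * (z * (1 - y + y * z) ^+ k).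
    by rewrite ler_wpM2l ?subr_ge0.
  have -> : (1 - (y * bin_tail k t y + (1 - y) * bin_tail k t.+1 y)) * z ^+ t.+1 =
    y * z * ((1 - bin_tail k t y) * z ^+ t) + (1 - y) * ((1 - bin_tail k t.+1 y) * z ^+ t.+1).
    by rewrite exprS; ring.
  by apply: le_trans (lerD h1 h2) _; rewrite exprS le_eqVlt; apply/orP/or_introl/eqP; ring.
Qed.

(* Markov's inequality for [2 ^ X], with [X] binomial. *)
Lemma bin_tail_upper k t y : 0 <= y <= 1 -> bin_tail k t y * 2 ^+ t <= (1 + y) ^+ k.
Proof.
move=> /andP[y0 y1]; have M1 : 1 <= 1 + y by rewrite lerDl.
elim: k t => [|k IH] [|t] /=.
- by rewrite !expr0 mulr1.
- by rewrite mul0r expr0.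
- by rewrite mul1r expr0 exprn_ege1.
- have h1 := ler_wpM2l (mulr_ge0 y0 (ler0n R 2)) (IH t).
  have h2 : (1 - y) * (bin_tail k t.+1 y * 2 ^+ t.+1) <= (1 - y) * (1 + y) ^+ k.
    by rewrite ler_wpM2l ?subr_ge0.
  have -> : (y * bin_tail k t y + (1 - y) * bin_tail k t.+1 y) * 2 ^+ t.+1 =
    y * 2 * (bin_tail k t y * 2 ^+ t) + (1 - y) * (bin_tail k t.+1 y * 2 ^+ t.+1).
    by rewrite [in LHS]exprS [in RHS]exprS; ring.
  by apply: le_trans (lerD h1 h2) _; rewrite exprS le_eqVlt; apply/orP/or_introl/eqP; ring.
Qed.

Lemma bin_tail_ge0 k t y : 0 <= y <= 1 -> 0 <= bin_tail k t y.
Proof.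
move=> /andP[y0 y1]; elim: k t => [|k IH] [|t] //=.
by rewrite addr_ge0 ?mulr_ge0 ?subr_ge0.
Qed.

Lemma bin_tail_certain k t : (t <= k)%N -> bin_tail k t (1 : R) = 1.
Proof.
elim: k t => [|k IH] [|t] //= tk.
by rewrite IH // subrr mul0r mulr1 addr0.
Qed.

(** With [a = - ln (1 - c)], the factorisation [1 - c ^ 2 = (1 + c) (1 - c)] is at most
    [exp (c - a)], so [t a <= k (a - c)] suffices. As [4 t <= c k], this reduces to
    [c <= a (1 - c / 4)]. *)
Lemma expr_sqr_le c k t : 0 < c -> c < 1 -> 4 * t%:R <= c * k%:R ->
  (1 - c ^+ 2) ^+ k <= (1 - c) ^+ t.
Proof.
move=> c0 c1 tk; pose a := - ln (1 - c).
have ea : 1 - c = expR (- a) by rewrite /a opprK lnK // posrE subr_gt0.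
(* With [r = sqrt (1 - c)], [a >= 2 (1 - r)] yields [a (1 - c / 4) >= c]. *)
pose r := expR (- a / 2).
have r2 : r ^+ 2 = 1 - c by rewrite ea expr2 -expRD; congr expR; field.
have r0 : 0 < r := expR_gt0 _.
have ra : 1 + (- a / 2) <= r := expR_ge1Dx _.
have r1 : r <= 1 by rewrite -(@ler_pXn2r _ 2) ?nnegrE ?(ltW r0) // r2 expr1n; lra.
have a0 : 0 <= a by lra.
have ac : c <= a * (1 - c / 4).
  have h : 2 * (1 - r) * (1 - c / 4) <= a * (1 - c / 4) by rewrite ler_wpM2r; lra.
  apply: le_trans h; have -> : c = 1 - r ^+ 2 by rewrite r2; ring.
  rewrite -subr_ge0.
  have -> : 2 * (1 - r) * (1 - (1 - r ^+ 2) / 4) - (1 - r ^+ 2) = (1 - r) ^+ 2 * (1 - r) / 2.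
    by field.
  by rewrite divr_ge0 ?mulr_ge0 ?sqr_ge0 ?subr_ge0.
apply: (@le_trans _ _ (expR (c - a) ^+ k)).
  apply: lerXn2r; rewrite ?nnegrE ?expR_ge0 //; first by rewrite subr_ge0; nra.
  have -> : 1 - c ^+ 2 = (1 + c) * (1 - c) by ring.
  by rewrite ea expRD ler_pM2r ?expR_gt0 // expR_ge1Dx.
rewrite ea -!expRM_natl ler_expR.
have k0 : 0 <= k%:R :> R by [].
have h1 := ler_wpM2r a0 tk.
have h2 := ler_wpM2l k0 ac.
lra.
Qed.

(** Failure means at most [t - 1] successes, which leaves a spare factor [z] in [bin_tail_lower]. At
    [z = 1 - c] that factor is exactly the allowed failure probability, and [expr_sqr_le] cancels
    the rest. *)
Lemma bin_tail_complete c k t y : 0 < c -> c <= y <= 1 -> 4 * t%:R <= c * k%:R ->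
  c <= bin_tail k t y.
Proof.
move=> c0 /andP[cy y1] tk; have [c1|c1] := ltP c 1; last first.
  have -> : y = 1 by lra.
  rewrite bin_tail_certain; first lra.
  by rewrite -(ler_nat R); have : 0 <= t%:R :> R by []; have : 0 <= k%:R :> R by []; nra.
have z0 : 0 < 1 - c by lra.
have y01 : 0 <= y <= 1 by apply/andP; split; lra.
have z01 : 0 <= 1 - c <= 1 by apply/andP; split; lra.
have := bin_tail_lower k t y01 z01.
have -> : 1 - y + y * (1 - c) = 1 - y * c by ring.
have h1 : (1 - y * c) ^+ k <= (1 - c ^+ 2) ^+ k by apply: lerXn2r; rewrite ?nnegrE; nra.
move=> h; have : (1 - bin_tail k t y) * (1 - c) ^+ t <= (1 - c) * (1 - c) ^+ t.
  apply: le_trans h _; rewrite ler_pM2l //; apply: le_trans h1 _.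
  exact: expr_sqr_le.
by rewrite ler_pM2r ?exprn_gt0 //; lra.
Qed.

Lemma exists_natceil x : 0 <= x -> exists n : nat, x <= n%:R :> R /\ n%:R <= x + 1 :> R.
Proof.
move=> x0; exists (Num.truncn x).+1; rewrite ltW ?truncnS_gt //.
by rewrite -addn1 natrD lerD2r truncn_le.
Qed.

Lemma expr_halved_le e m : 0 <= e <= 1 -> (1 - e / 2) ^+ m <= expR (- (m%:R * e / 2)).
Proof.
move=> /andP[e0 e1].
have -> : - (m%:R * e / 2) = m%:R * (- (e / 2)) by ring.
rewrite expRM_natl; apply: lerXn2r; rewrite ?nnegrE ?expR_ge0; [lra|by []|].
exact: expR_ge1Dx.
Qed.

Lemma halved_expr_ge0 e m : 0 <= e <= 1 -> 0 <= (1 - e / 2) ^+ m.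
Proof. by move=> /andP[e0 e1]; apply: exprn_ge0; lra. Qed.

(* If [s] is not small compared with [(c - s) ^ 4], one use of [Y] and about [2 / s]
   swap tests suffice; otherwise [t] is about [4 ln (1 / s)], [k] about [4 t / c], and
   [m = 2 k] makes the decay of the swap tests absorb the growth of the tail in [e]. *)
Lemma amplification c s : 0 < s -> s < c -> c <= 1 ->
  exists k t m,
    [/\ forall y, c <= y <= 1 -> c <= bin_tail k t y,
        forall e y, 0 <= e <= 1 -> 0 <= y <= 1 -> y <= s + e ->
          (1 - e / 2) ^+ m * bin_tail k t y <= s &
        (k + 2 * m)%:R <= 200 * ln (s^-1 + 10) * (c - s) ^- 4].
Proof.
move=> s0 sc c1; pose g := c - s; pose G := g ^- 4; pose L := ln (s^-1 + 10).
have g0 : 0 < g by rewrite subr_gt0.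
have g1 : g <= 1 by rewrite /g; lra.
have si0 : 0 < s^-1 by rewrite invr_gt0.
have G1 : 1 <= G by rewrite /G invf_ge1 ?exprn_gt0 // exprn_ile1 // ltW.
(* The summand 10 in the logarithm keeps [L] away from 0, so additive constants can be absorbed into
   multiples of [L]. *)
have L9 : 1 / 2 <= L.
  have h : 1 + (- L) <= (s^-1 + 10)^-1.
    by apply: le_trans (expR_ge1Dx _) _; rewrite expRN /L lnK ?lexx // posrE; lra.
  have h10 : (s^-1 + 10)^-1 <= 10^-1 by rewrite lef_pV2 ?posrE; lra.
  have h20 : 10^-1 <= 1 / 2 :> R by rewrite div1r lef_pV2 ?posrE; lra.
  lra.
(* In the first case [1 / s <= 20 G], so [2 / s] swap tests are affordable, and their decay
   [exp (- e / s)] offsets [s + e <= s exp (e / s)]. In the second case [s <= c / 20]. *)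
have [sg|sg] := leP (g ^+ 4 / 20) s.
  have [m [m1 m2]] := @exists_natceil (2 / s) ltac:(by apply: divr_ge0; lra).
  exists 1%N, 1%N, m; split=> [y /andP[] //=|e y e01 y01 ye|]; first by rewrite mulr1 mulr0 addr0.
    rewrite /= mulr1 mulr0 addr0; case/andP: (e01) => e0 e1.
    apply: (@le_trans _ _ (expR (- (m%:R * e / 2)) * (s * expR (e / s)))).
      apply: ler_pM; [exact: halved_expr_ge0|by case/andP: y01|exact: expr_halved_le|].
      apply: le_trans ye _; have -> : s + e = s * (1 + e / s) by field; rewrite gt_eqF.
      by rewrite ler_pM2l // expR_ge1Dx.
    rewrite mulrCA -expRD ger_pMr // expR_le1.
    have me : e / s <= m%:R * e / 2 by have := ler_wpM2r e0 m1; lra.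
    lra.
  have s20 : s^-1 <= 20 * G.
    have -> : 20 * G = (g ^+ 4 / 20)^-1 by rewrite invf_div.
    by rewrite lef_pV2 ?posrE // divr_gt0 ?exprn_gt0.
  rewrite natrD natrM -/g -/G -/L.
  have : G / 2 <= L * G by nra.
  lra.
pose l := - ln s.
have l0 : 0 <= l by rewrite /l oppr_ge0 ln_le0 //; lra.
have lL : l <= L.
  by rewrite /l -lnV ?posrE // /L ler_ln ?posrE; lra.
have [t [t1 t2]] := @exists_natceil (4 * l) ltac:(lra).
have c0 : 0 < c by lra.
have ci : 1 <= c^-1 by rewrite invf_ge1.
have tt0 : 0 <= t%:R :> R by [].
have [k [k1 k2]] := @exists_natceil (4 * t%:R / c) ltac:(by apply: divr_ge0; lra).
have l1 : 0 < l by rewrite /l oppr_gt0 ln_lt0 // s0 /=; lra.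
have t_ge1 : 1 <= t%:R :> R by rewrite ler1n lt0n; apply/eqP => t0; rewrite t0 in t1; lra.
have kc : 4 * t%:R <= c * k%:R.
  by have := ler_wpM2l (ltW c0) k1; rewrite mulrCA mulfV ?gt_eqF // mulr1.
exists k, t, (2 * k)%N; split=> [y cy|e y e01 y01 ye|]; first exact: bin_tail_complete.
  case/andP: (e01) => e0 e1; case/andP: (y01) => y0 y1.
  (* The expected number of acceptances at [e = 0] is far below the threshold: [k s] is at most
     [t / 5 + c / 20], and [t >= 1]. *)
  have ks : k%:R * s <= t%:R / 4.
    have c4 : g ^+ 4 <= c.
      apply: (@le_trans _ _ (c ^+ 4)); first by apply: lerXn2r; rewrite ?nnegrE /g; lra.
      by rewrite exprS ler_piMr ?exprn_ile1 // ltW.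
    have sc20 : s <= c / 20 by lra.
    have : k%:R * s <= (4 * t%:R / c + 1) * (c / 20) by apply: ler_pM => //; lra.
    have -> : (4 * t%:R / c + 1) * (c / 20) = t%:R / 5 + c / 20 by field; rewrite gt_eqF.
    lra.
  have half : (2 : R) ^- t <= expR (- (t%:R / 2)).
    have -> : - (t%:R / 2) = t%:R * (- (1 / 2)) :> R by field.
    rewrite expRM_natl -exprVn; apply: lerXn2r; rewrite ?nnegrE ?expR_ge0 ?invr_ge0 //.
    by apply: (le_trans _ (expR_ge1Dx _)); lra.
  have bt : bin_tail k t y <= expR (k%:R * (s + e)) * expR (- (t%:R / 2)).
    apply: (@le_trans _ _ (expR (k%:R * (s + e)) * 2 ^- t)); last first.
      by rewrite ler_pM2l ?expR_gt0.
    rewrite ler_pdivlMr ?exprn_gt0 //; apply: le_trans (bin_tail_upper _ _ y01) _.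
    rewrite expRM_natl; apply: lerXn2r; rewrite ?nnegrE ?expR_ge0 //; first lra.
    by apply: (le_trans _ (expR_ge1Dx _)); lra.
  apply: (@le_trans _ _ (expR (- ((2 * k)%:R * e / 2)) *
                        (expR (k%:R * (s + e)) * expR (- (t%:R / 2))))).
    apply: (@le_trans _ _ ((1 - e / 2) ^+ (2 * k) * (expR (k%:R * (s + e)) * expR (- (t%:R / 2))))).
      by rewrite ler_wpM2l // halved_expr_ge0.
    by rewrite ler_pM2r ?mulr_gt0 ?expR_gt0 // expr_halved_le.
  (* With [m = 2 k] the terms in [e] cancel; what remains is [k s - t / 2 <= - t / 4 <= ln s], by
     [t >= 4 l]. *)
  rewrite -!expRD -[leRHS]lnK ?posrE // ler_expR natrM.
  have -> : - (2 * k%:R * e / 2) + (k%:R * (s + e) + - (t%:R / 2)) = k%:R * s - t%:R / 2 by field.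
  rewrite -[ln s]opprK -/l; lra.
(* The cost is [5 k], with [k <= (16 l + 5) / c] and [1 / c <= G]; the constant 25 is absorbed by
   [L >= 1 / 2]. *)
rewrite mulnA -mulSn natrM -/g -/G -/L.
have cG : c^-1 <= G.
  rewrite /G lef_pV2 ?posrE ?exprn_gt0 //.
  apply: (@le_trans _ _ (c ^+ 4)); first by apply: lerXn2r; rewrite ?nnegrE /g; lra.
  by rewrite exprS ler_piMr ?exprn_ile1 // ltW.
have h1 : k%:R <= 4 * (4 * l + 1) * c^-1 + 1.
  by apply: le_trans k2 _; rewrite lerD2r ler_pM2r ?invr_gt0 //; lra.
have h2 : (16 * l + 5) * c^-1 <= (16 * L + 5) * G by apply: ler_pM; lra.
have h3 : 5 * (16 * L + 5) * G <= 200 * L * G by rewrite ler_pM2r; lra.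
have -> : (2 * 2).+1%:R = 5 :> R by [].
lra.
Qed.

End Amplification.

(** * Completeness and soundness *)

Section SymmetricTester.
Variables (R : realType) (d : nat) (P : property R d) (c s : R) (N : nat).
Local Notation C := R[i].
Local Notation idx := {ffun 'I_N -> bip d}.

(** Indexes the tester conditions as affine inequalities: the two bounds of an effect at each
    vector, then one inequality for each yes- or no-instance. *)
Let constraint : Type :=
  (((idx -> C) + (idx -> C)) + ({rho | P_yes P rho} + {rho | P_no P rho}))%type.

Let cst (a : constraint) : C :=
  match a with
  | inl (inl _) => 0
  | inl (inr v) => ip v v
  | inr (inl _) => - c%:C
  | inr (inr _) => s%:C
  end.

Let lin (a : constraint) : op R idx := fun i j =>
  match a with
  | inl (inl v) => (v i)^* * v j
  | inl (inr v) => - ((v i)^* * v j)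
  | inr (inl rho) => tpow (proj1_sig rho) j i
  | inr (inr rho) => - tpow (proj1_sig rho) j i
  end.

Let quad_lin (T : op R idx) v :
  \sum_i \sum_j (v i)^* * v j * T i j = ip v (app T v).
Proof.
rewrite -quad_ip; apply: eq_bigr => i _; apply: eq_bigr => j _.
by rewrite mulrAC.
Qed.

Let trace_lin (T : op R idx) rho :
  \sum_i \sum_j tpow rho j i * T i j = op_tr (op_mul T (tpow rho)).
Proof. by apply: eq_bigr => i _; apply: eq_bigr => j _; rewrite mulrC. Qed.

Let sum_neg (T L : op R idx) :
  \sum_i \sum_j - L i j * T i j = - \sum_i \sum_j L i j * T i j.
Proof.
rewrite -sumrN; apply: eq_bigr => i _; rewrite -sumrN.
by apply: eq_bigr => j _; rewrite mulNr.
Qed.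

Let testerE (T : op R idx) :
  tester P c s T <-> forall a, 0 <= cst a + \sum_i \sum_j lin a i j * T i j.
Proof.
split=> [[eT [Ty Tn]] [[v|v]|[[rho h]|[rho h]]] /=|h].
- by rewrite quad_lin add0r; case: eT => /psdP.
- by rewrite (sum_neg T (fun i j => (v i)^* * v j)) quad_lin subr_ge0 effect_le.
- by rewrite trace_lin addrC subr_ge0; exact: Ty.
- by rewrite (sum_neg T (fun i j => tpow rho j i)) trace_lin subr_ge0; exact: Tn.
split; [|split].
- apply: effectP => v; split.
    by have := h (inl (inl v)); rewrite /= quad_lin add0r.
  have := h (inl (inr v)).
  by rewrite /= (sum_neg T (fun i j => (v i)^* * v j)) quad_lin subr_ge0.
- move=> rho hr; have := h (inr (inl (exist _ rho hr))).
  by rewrite /= trace_lin addrC subr_ge0.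
- move=> rho hr; have := h (inr (inr (exist _ rho hr))).
  by rewrite /= (sum_neg T (fun i j => tpow rho j i)) trace_lin subr_ge0.
Qed.

Let sqnorm_tr (T : op R idx) : sqnorm T = op_tr (op_mul (op_adj T) T).
Proof.
rewrite /sqnorm exchange_big; apply: eq_bigr => i _; apply: eq_bigr => j _ /=.
by rewrite normCK op_adjE mulrC.
Qed.

(** Conjugation by [U ^ N] on Bob's side and permutation of the copies both preserve the set of
    testers and the Hilbert-Schmidt norm, so one minimizer has both symmetries. *)
Lemma symmetric_tester : unit_inv_B P -> (exists T : op R idx, tester P c s T) ->
  exists T : op R idx, [/\ tester P c s T, forall X, local_commute T X &
    forall (p : 'S_N) i j, T (pact p i) (pact p j) = T i j].
Proof.
move=> inv [T0 hT0].
have [|T [KT fixT]] := @affine_fixed_point R idx constraint cst lin.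
  by exists T0; apply/testerE.
move/testerE in KT; exists T; split=> //.
- apply: local_commute_all => U uU.
  have [h1 h2] := unitary_tpow N uU; set V := tpow (idtens U) in h1 h2.
  pose F S := op_mul (op_adj V) (op_mul S V).
  have FT : F T = T.
    apply: fixT => [S /testerE[eS [Sy Sn]]|].
      have trF rho : op_tr (op_mul (F S) (tpow rho)) = op_tr (op_mul S
          (tpow (op_mul (op_mul (idtens U) rho) (op_adj (idtens U))))).
        by rewrite !tpow_mul tpow_adj -/V /F -op_mulA op_trC -!op_mulA.
      apply/testerE; split; [|split] => [|rho hr|rho hr].
      + apply: effectP => v; rewrite /F !app_mul ip_adj op_adjK.
        have -> : ip v v = ip (app V v) (app V v) by rewrite ip_adj -app_mul h2 app_id.
        by case: (eS) => /psdP pS _; split; [exact: pS | exact: effect_le].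
      + by rewrite trF; apply: Sy; apply: (inv U uU rho).1.
      + by rewrite trF; apply: Sn; apply: (inv U uU rho).2.
    have e : op_mul (op_adj (F T)) (F T) = op_mul (op_adj V) (op_mul (op_mul (op_adj T) T) V).
      by rewrite /F !op_adjM op_adjK -!op_mulA (op_mulA V) h1 op_1mul.
    by rewrite !sqnorm_tr e [LHS]op_trC -(op_mulA _ V) h1 op_mul1.
  by rewrite /local_commute -/V -[in RHS]FT /F op_mulA h1 op_1mul.
- move=> p i j.
  pose F (S : op R idx) : op R idx := fun i j => S (pact p i) (pact p j).
  suff FT : F T = T by rewrite -[in RHS]FT.
  have tpow_pact rho i' j' : tpow (N := N) rho (pact p i') (pact p j') = tpow rho i' j' :> C.
    rewrite /tpow [RHS](reindex_inj (@perm_inj _ p)).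
    by apply: eq_bigr => k _; rewrite !ffunE.
  have sum2 (G : idx -> idx -> C) : \sum_i \sum_j G (pact p i) (pact p j) = \sum_i \sum_j G i j.
    rewrite -[RHS](sum_pact p); apply: eq_bigr => i' _.
    by rewrite (sum_pact p (G (pact p i'))).
  apply: fixT => [S /testerE[eS [Sy Sn]]|]; last exact: (sum2 (fun i j => `|T i j| ^+ 2)).
  have trF rho : op_tr (op_mul (F S) (tpow rho)) = op_tr (op_mul S (tpow rho)).
    rewrite /op_tr /op_mul -(sum2 (fun i j => S i j * tpow rho j i)).
    by apply: eq_bigr => i' _; apply: eq_bigr => j' _; rewrite tpow_pact.
  apply/testerE; split; [|split] => [|rho hr|rho hr].
  + apply: effectP => v; pose v' i := v (pact p^-1%g i).
    have vE i' : v i' = v' (pact p i') by rewrite /v' pactM mulVg pact1.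
    have -> : ip v (app (F S) v) = ip v' (app S v').
      rewrite -!quad_ip -(sum2 (fun i j => (v' i)^* * S i j * v' j)).
      by apply: eq_bigr => i' _; apply: eq_bigr => j' _; rewrite !vE.
    have -> : ip v v = ip v' v'.
      rewrite /ip -(sum_pact p (fun i => (v' i)^* * v' i)).
      by apply: eq_bigr => i' _; rewrite vE.
    by case: (eS) => /psdP pS _; split; [exact: pS | exact: effect_le].
  + by rewrite trF; exact: Sy.
  + by rewrite trF; exact: Sn.
Qed.

End SymmetricTester.

(** * Spectral bounds for mixed inputs *)

Section Soundness.
Variables (R : realType) (I : finType) (rho : op R I).
Local Notation C := R[i].
Hypothesis drho : density rho.

Lemma density_spectral : exists (u : I -> I -> C) (p : I -> R),
  [/\ forall k m, ip (u k) (u m) = (k == m)%:R,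
      rho = fun i j => \sum_k (p k)%:C * (u k i * (u k j)^*),
      forall k, 0 <= p k & \sum_k p k = 1].
Proof.
case: drho => /psd_spectral[u [p [ou eR p0]]] tr1.
have er : rho = fun i j => \sum_k (p k)%:C * (u k i * (u k j)^*).
  by apply: funext => i; apply: funext => j.
exists u, p; split=> //; apply: (@complexI R); rewrite rmorph1 -tr1 er rmorph_sum.
rewrite -[op_tr _]/(op_tr (fun i j => _)) -(op_1mul (fun i j => \sum_k _)) tr_mul_sum.
by apply: eq_bigr => k _; rewrite app_id ou eqxx mulr1.
Qed.

Variable N : nat.
Local Notation idx := {ffun 'I_N -> I}.

Lemma tpow_spectral : exists (K : finType) (w : K -> idx -> C) (q : K -> R) (k0 : K) (v : I -> C),
  [/\ tpow rho = fun i j => \sum_k (q k)%:C * (w k i * (w k j)^*),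
      forall k, 0 <= q k & \sum_k q k = 1] /\
  [/\ forall k, ip (w k) (w k) = 1, w k0 = tvec v &
      complex.Re (op_tr (op_mul rho rho)) ^+ N <= q k0].
Proof.
have [u [p [ou eR p0 p1]]] := density_spectral.
have tr2 : op_tr (op_mul rho rho) = (\sum_k p k ^+ 2)%:C.
  rewrite {2}eR tr_mul_sum rmorph_sum; apply: eq_bigr => k _.
  rewrite (app_eigenvector (A := rho) (l := p) ou) => [|i j]; last by rewrite eR.
  by rewrite ipZr ou eqxx mulr1 -rmorphM -expr2.
(* The purity is the mean of the eigenvalues weighted by themselves, hence at most one of them. The
   constant index at [k0] then carries the weight [p k0 ^ N]. *)
have [k0 hk0] : exists k0, \sum_k p k ^+ 2 <= p k0.
  apply/existsP; apply: contraT; rewrite negb_exists => /forallP h.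
  set r := \sum_k p k ^+ 2 in h *.
  have hp k : p k < r by rewrite ltNge; exact: h.
  have : \sum_k p k * (r - p k) = 0.
    under eq_bigr do rewrite mulrBr -expr2.
    by rewrite sumrB -mulr_suml p1 mul1r subrr.
  move=> /psumr_eq0P z.
  have pz k : p k = 0.
    have /eqP : p k * (r - p k) = 0.
      by apply: z => // m _; rewrite mulr_ge0 // subr_ge0 ltW.
    by rewrite mulf_eq0 subr_eq0 [r == _]gt_eqF // orbF => /eqP.
  by have := p1; rewrite big1 // => /eqP; rewrite eq_sym oner_eq0.
exists {ffun 'I_N -> I}, (fun h i : idx => \prod_k u (h k) (i k)), (fun h : idx => \prod_k p (h k)),
  [ffun=> k0], (u k0).
split; split.
- apply: funext => i; apply: funext => j; rewrite {1}eR /tpow bigA_distr_bigA.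
  apply: eq_bigr => h _; rewrite big_split big_split /=.
  by rewrite !rmorph_prod.
- by move=> h; apply: prodr_ge0.
- by rewrite -(bigA_distr_bigA (fun (_ : 'I_N) k => p k)) big1.
- move=> h; rewrite /ip.
  transitivity (\prod_k ip (u (h k)) (u (h k))).
    rewrite /ip bigA_distr_bigA; apply: eq_bigr => i _.
    by rewrite rmorph_prod -big_split.
  by rewrite big1 // => k _; rewrite ou eqxx.
- by apply: funext => i; apply: eq_bigr => k _; rewrite ffunE.
- rewrite tr2 /=; under [leRHS]eq_bigr do rewrite ffunE.
  rewrite prodr_const card_ord; apply: lerXn2r; rewrite ?nnegrE //.
  by apply: sumr_ge0 => k _; rewrite sqr_ge0.
Qed.

Lemma tr_effect_bounds (E : op R idx) : effect E ->
  0 <= op_tr (op_mul E (tpow rho)) <= 1.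
Proof.
move=> eE; have [K [w [q [_ [_ [[er q0 q1] [w1 _ _]]]]]]] := tpow_spectral.
have pE k : 0 <= ip (w k) (app E (w k)) by case: eE => /psdP.
rewrite er tr_mul_sum; apply/andP; split.
  by apply: sumr_ge0 => k _; rewrite mulr_ge0 ?ler0c.
apply: (@le_trans _ _ (\sum_k (q k)%:C)); last by rewrite -rmorph_sum /= q1.
by apply: ler_sum => k _; rewrite ler_piMr ?ler0c // -(w1 k) effect_le.
Qed.

(* [E] and [T] agree on the tensor power of the top eigenvector, whose weight is [x];
   the rest of [rho ^ N] has weight [1 - x]. *)
Lemma tr_effect_compare (E T : op R idx) : effect E -> effect T ->
  (forall v, ip (tvec v) (app E (tvec v)) = ip (tvec v) (app T (tvec v))) ->
  exists x : R, [/\ complex.Re (op_tr (op_mul rho rho)) ^+ N <= x, 0 <= x <= 1 &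
    op_tr (op_mul E (tpow rho)) <= op_tr (op_mul T (tpow rho)) + (1 - x)%:C].
Proof.
move=> eE eT ET; have [K [w [q [k0 [v [[er q0 q1] [w1 wv tx]]]]]]] := tpow_spectral.
have pT k : 0 <= ip (w k) (app T (w k)) by case: eT => /psdP.
have q1' : \sum_(k | k != k0) q k = 1 - q k0.
  by have := q1; rewrite (bigD1 k0) //= => <-; rewrite addrAC subrr add0r.
exists (q k0); split=> //.
  by rewrite q0 -subr_ge0 -q1' sumr_ge0.
rewrite er !tr_mul_sum (bigD1 k0) //= [X in _ <= X + _](bigD1 k0) //= wv ET -wv.
rewrite -addrA lerD2l -[leLHS]add0r; apply: lerD.
  by apply: sumr_ge0 => k _; rewrite mulr_ge0 ?ler0c.
rewrite -q1' rmorph_sum; apply: ler_sum => k _.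
by rewrite ler_piMr ?ler0c // -(w1 k) effect_le.
Qed.

End Soundness.

Lemma pure_purity (R : realType) (I : finType) (rho : op R I) (v : I -> R[i]) :
  density rho -> rho = (fun i j => v i * (v j)^*) -> op_tr (op_mul rho rho) = 1.
Proof.
move=> [_ tr1] er; have v1 : ip v v = 1.
  by rewrite -tr1 er /ip; apply: eq_bigr => i _; rewrite mulrC.
rewrite {2}er tr_rank1 er.
have -> : app (fun i j => v i * (v j)^*) v = fun i => ip v v * v i.
  apply: funext => i; rewrite /app /ip mulr_suml.
  by apply: eq_bigr => j _; rewrite -mulrA mulrC.
by rewrite ipZr v1 mulr1.
Qed.

Theorem theorem1p4 (R : realType) (d : nat) (P : property R d) (c s : R) (N0 : nat) :
  unit_inv_B P ->
  (forall rho, P_yes P rho -> pure_state rho) ->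
  0 < s -> s < c -> c <= 1 ->
  (exists T : op R {ffun 'I_N0 -> bip d}, tester P c s T) ->
  exists (N : nat) (T : op R {ffun 'I_N -> bip d}),
    (N%:R <= (Num.ceil (200 * ln (s^-1 + 10) * (c - s) ^- 4))%:~R * N0%:R :> R) /\
    oneway_BA T /\ tester P c s T.
Proof.
move=> inv pure s0 sc c1 /(symmetric_tester inv)[T [[eT [Ty Tn]] cT pT]].
pose E := lift_alice (reduction T).
have eE : effect E by apply/lift_alice_effect/reduction_effect.
have ET := ip_reduction cT.
pose y rho := complex.Re (op_tr (op_mul E (tpow rho))).
have yE rho : density rho -> op_tr (op_mul E (tpow rho)) = (y rho)%:C.
  by move=> dr; rewrite ReK //; case/andP: (tr_effect_bounds dr eE).
have y01 rho : density rho -> 0 <= y rho <= 1.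
  by move=> dr; have := tr_effect_bounds dr eE; rewrite yE // ler0c lecR.
have ytest : alice_test N0 y.
  by exists (reduction T); split; [exact: reduction_effect | exact: yE].
have [k [t [m [compl sound cost]]]] := amplification s0 sc c1.
have [T' [oT aT]] := locc_prod (alice_locc (alice_bin_tail k t ytest))
                               (locc_exp m (block_swap_test R d N0)).
exists (k * N0 + m * (N0 + N0))%N, T'; split; [|split=> //; split; [|split]].
- have -> : (k * N0 + m * (N0 + N0) = (k + 2 * m) * N0)%N.
    by rewrite addnn -mul2n mulnA [(m * 2)%N]mulnC mulnDl.
  rewrite natrM ler_wpM2r //; apply: le_trans cost _; exact: ceil_ge.
- exact: oneway_effect.
- move=> rho yes; have [dr [v er]] := pure _ yes.
  rewrite aT // (pure_purity dr er) /= expr1n.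
  rewrite (_ : (1 + 1) / 2 = 1) ?expr1n ?mulr1; last by field.
  rewrite lecR; apply: compl; case/andP: (y01 _ dr) => _ ->; rewrite andbT.
  (* The swap tests have dropped out by purity; on a tensor power of a vector [E] accepts exactly as
     [T] does, hence with probability at least [c]. *)
  rewrite -lecR -yE // er tpow_rank1 tr_rank1 ET -tr_rank1 -tpow_rank1 -er.
  exact: Ty.
- move=> rho no; have dr := P_no_density no.
  have [x [tx x01 h]] := tr_effect_compare dr eE eT ET.
  rewrite aT // lecR mulrC; case/andP: (x01) => x0 x1.
  (* At [e = 1 - x] the swap-test bound [(1 + x) / 2] is [1 - e / 2], the form in which [sound]
     expects it. *)
  have e01 : 0 <= 1 - x <= 1 by apply/andP; split; lra.
  apply: (le_trans _ (sound (1 - x) (y rho) e01 (y01 _ dr) _)).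
    apply: ler_wpM2r; first exact/bin_tail_ge0/y01.
    have t0 : 0 <= complex.Re (op_tr (op_mul rho rho)) ^+ N0.
      by rewrite exprn_ge0 // -ler0c ReK ?tr_sqr_ge0.
    by apply: lerXn2r; rewrite ?nnegrE; lra.
  rewrite -lecR -yE // rmorphD /=; apply: le_trans h _.
  by rewrite lerD2r; exact: Tn.
Qed.
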